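(* An $m$-th root metric space $(M,F)$ is projectively flat if and only if around every point of $M$ there is a local coordinate system in which $$m\,h_{00}\,\gamma_{j0\dots0}=h_{j0}\,y^r\,h_{00,r},\qquad j=1,\dots,n,$$ holds identically in $(x,y)$.
   Context: Let $M$ be a smooth $n$-dimensional manifold with induced coordinates $(x^i,y^i)$ on $TM$. An $m$-th root metric space ($m\ge 2$) is $(M,F)$ with $F=\sqrt[m]{a_{i_1\dots i_m}(x)y^{i_1}\cdots y^{i_m}}$, where $a_{i_1\dots i_m}$ is totally symmetric and $g_{ij}=\frac12\frac{\partial^2F^2}{\partial y^i\partial y^j}$ is nondegenerate on $TM\setminus\{0\}$ (at the points where $F$ is defined and smooth); $g$ may have arbitrary signature. Notation: an index $0$ denotes contraction with $y$, and $_{,r}$ denotes $\partial/\partial x^r$ (at fixed $y$). The polynomial flag metric is $h_{ij}=a_{ij0\dots0}=a_{iji_3\dots i_m}y^{i_3}\cdots y^{i_m}$, so $h_{j0}=a_{ji_2\dots i_m}y^{i_2}\cdots y^{i_m}$, $h_{00}=a_{i_1\dots i_m}y^{i_1}\cdots y^{i_m}=F^m$ and $h_{00,r}=\frac{\partial a_{i_1\dots i_m}}{\partial x^r}y^{i_1}\cdots y^{i_m}$. Further, $\gamma_{j\,j_1\dots j_m}=\frac1{m(m-1)}\Big(\sum_{(j_1,\dots,j_m)}\frac{\partial a_{jj_2\dots j_m}}{\partial x^{j_1}}-\frac{\partial a_{j_1\dots j_m}}{\partial x^j}\Big)$, where $\sum_{(j_1,\dots,j_m)}$ is the cyclic sum,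 and $\gamma_{j0\dots0}=\gamma_{j\,j_1\dots j_m}y^{j_1}\cdots y^{j_m}$. $(M,F)$ is projectively flat if its geodesics are straight lines, i.e. around every point there is a coordinate system in which the geodesics are, as point sets, straight lines (equivalently, $(M,F)$ is projective to a locally Minkowski space). *)

(* Defs.v *)
From mathcomp Require Import all_boot all_order all_algebra.
From mathcomp Require Import all_classical all_reals all_analysis.
Import Order.TTheory GRing.Theory Num.Theory numFieldNormedType.Exports.

Set Implicit Arguments.
Unset Strict Implicit.
Unset Printing Implicit Defensive.

Local Open Scope classical_set_scope.
Local Open Scope ring_scope.

Section SmoothManifolds.
Context {R : realType}.

Fixpoint Ck (V W : normedModType R) (k : nat) (U : set V) (f : V -> W) : Prop :=
  if k is k'.+1 then
    (forall x, U x -> differentiable f x) /\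
    (forall v : V, Ck k' U ('D_v f))
  else forall x, U x -> {for x, continuous f}.

(* Meant for open U. *)
Definition smooth_on (V W : normedModType R) (U : set V) (f : V -> W) : Prop :=
  forall k, Ck k U f.

Definition partial (n : nat) (W : normedModType R) (i : 'I_n)
    (f : 'rV[R]_n -> W) (x : 'rV[R]_n) : W :=
  'D_(delta_mx 0 i) f x.

(* The values of [chart_coord] outside [cdom] and of [chart_inv] outside [cimg] are
   irrelevant. *)
Record chart (M : topologicalType) (n : nat) := Chart {
  cdom : set M;
  chart_coord : M -> 'rV[R]_n;
  chart_inv : 'rV[R]_n -> M;
  open_cdom : open cdom;
  open_cimg : open (chart_coord @` cdom);
  chart_coordK : forall p, cdom p -> chart_inv (chart_coord p) = p;
  chart_coord_continuous : {within cdom, continuous chart_coord};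
  chart_inv_continuous : {within chart_coord @` cdom, continuous chart_inv}
}.

Definition cimg (M : topologicalType) (n : nat) (phi : chart M n) :
  set 'rV[R]_n := chart_coord phi @` cdom phi.

Definition overlap (M : topologicalType) (n : nat) (phi psi : chart M n) :
  set 'rV[R]_n := chart_coord phi @` (cdom phi `&` cdom psi).

Definition transition (M : topologicalType) (n : nat) (phi psi : chart M n) :
  'rV[R]_n -> 'rV[R]_n := chart_coord psi \o chart_inv phi.

Definition compatible (M : topologicalType) (n : nat) (phi psi : chart M n) :
    Prop :=
  smooth_on (overlap phi psi) (transition phi psi) /\
  smooth_on (overlap psi phi) (transition psi phi).

(* A smooth structure is a maximal atlas; its members are the local
   coordinate systems of the manifold. *)
Record smooth_structure (M : topologicalType) (n : nat) := SmoothStructure {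
  atlas : set (chart M n);
  atlas_cover : forall p : M, exists2 phi, atlas phi & cdom phi p;
  atlas_compatible : forall phi psi,
    atlas phi -> atlas psi -> compatible phi psi;
  atlas_maximal : forall phi,
    (forall psi, atlas psi -> compatible phi psi) -> atlas phi
}.

End SmoothManifolds.

Arguments chart : clear implicits.
Arguments smooth_structure : clear implicits.

Section Coordinates.
Context {R : realType}.
Variables (n m : nat).

(* In one coordinate system, the component a_{i_1...i_m}(x) is
   [a [:: i_1; ...; i_m] x]; only index lists of length m are meaningful. *)
Variable a : seq 'I_n -> 'rV[R]_n -> R.

(* a_{s 0...0}, the free indices s being followed by m - size s zeros. *)
Definition contract0 (s : seq 'I_n) (x y : 'rV[R]_n) : R :=
  \sum_(J : (m - size s).-tuple 'I_n) a (s ++ J) x * \prod_(i <- J) y 0 i.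

Definition h00 (x y : 'rV[R]_n) : R := contract0 [::] x y.
Definition h0 (j : 'I_n) (x y : 'rV[R]_n) : R := contract0 [:: j] x y.
Definition h00x (r : 'I_n) (x y : 'rV[R]_n) : R :=
  partial r (fun z => h00 z y) x.

(* [rot k J] is the cyclic permutation of J starting at its k-th entry. *)
Definition gamma (j : 'I_n) (J : m.-tuple 'I_n) (x : 'rV[R]_n) : R :=
  (m%:R * (m%:R - 1))^-1 *
  (\sum_(k < m) partial (tnth J k) (a (j :: behead (rot k J))) x
   - partial j (a J) x).

Definition gamma0 (j : 'I_n) (x y : 'rV[R]_n) : R :=
  \sum_(J : m.-tuple 'I_n) gamma j J x * \prod_(i <- J) y 0 i.

(* The real m-th root: negative arguments only matter when m is odd. *)
Definition mroot (z : R) : R := Num.sg z * `|z| `^ (m%:R^-1).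

Definition Fm (x y : 'rV[R]_n) : R := mroot (h00 x y).

(* The tangent vectors at which F is defined and smooth. Zeros of h00 are
   excluded: if F is smooth at (x, y), y != 0, and vanishes there, then F is
   linear in y at x, which contradicts [metric_nondegenerate] (n > 1) or
   [metric_domain_nonempty] (n = 1) below. *)
Definition admissible (x y : 'rV[R]_n) : Prop :=
  0 < h00 x y \/ (odd m /\ h00 x y < 0).

Definition gmx (x y : 'rV[R]_n) : 'M[R]_n :=
  \matrix_(i, j) (2^-1 * partial i (partial j (fun z => Fm x z ^+ 2)) y).

(* Coordinate expression x of a geodesic on the time interval ]t0, t1[:
   an extremal of the energy F^2, i.e. a solution of
     d/dt (dF^2/dy^i (x, x')) = dF^2/dx^i (x, x'). *)
Definition geodesic_curve (t0 t1 : R) (x : R -> 'rV[R]_n) : Prop :=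
  forall t, t \in `]t0, t1[ ->
    [/\ derivable x t 1, derivable (derive1 x) t 1, admissible (x t) (derive1 x t) &
      forall i : 'I_n,
        is_derive t 1
          (fun s => partial i (fun y => Fm (x s) y ^+ 2) (derive1 x s))
          (partial i (fun z => Fm z (derive1 x t) ^+ 2) (x t))].

End Coordinates.

(* An m-th root metric, given by the components [acomp phi] of its symmetric
   covariant tensor in each coordinate system phi, as functions on the image
   of phi. *)
Record mroot_metric (R : realType) (M : topologicalType) (n m : nat)
    (S : smooth_structure R M n) := MrootMetric {
  acomp : chart R M n -> seq 'I_n -> 'rV[R]_n -> R;
  acomp_smooth : forall phi (s : m.-tuple 'I_n),
    atlas S phi -> smooth_on (cimg phi) (acomp phi s);
  acomp_sym : forall phi (s t : m.-tuple 'I_n) x,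
    atlas S phi -> cimg phi x -> perm_eq s t ->
    acomp phi s x = acomp phi t x;
  acomp_tensor : forall phi psi (s : m.-tuple 'I_n) x,
    atlas S phi -> atlas S psi -> overlap phi psi x ->
    acomp phi s x =
      \sum_(J : m.-tuple 'I_n) acomp psi J (transition phi psi x) *
        \prod_(k < m) partial (tnth s k) (transition phi psi) x 0 (tnth J k);
  metric_domain_nonempty : forall phi x,
    atlas S phi -> cimg phi x -> exists y, admissible m (acomp phi) x y;
  metric_nondegenerate : forall phi x y,
    atlas S phi -> cimg phi x -> admissible m (acomp phi) x y ->
    \det (gmx m (acomp phi) x y) != 0
}.

Section ProjectiveFlatness.
Context {R : realType} {M : topologicalType} {n m : nat}.
Context {S : smooth_structure R M n}.
Variable a : mroot_metric m S.

(* The Euler-Lagrange equations being invariant under changes of coordinates,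
   a geodesic running inside the domain of phi may be tested in phi. *)
Definition geodesic_in (phi : chart R M n) (t0 t1 : R) (c : R -> M) : Prop :=
  (forall t, t \in `]t0, t1[ -> cdom phi (c t)) /\
  geodesic_curve m (acomp a phi) t0 t1 (chart_coord phi \o c).

Definition on_straight_line (t0 t1 : R) (x : R -> 'rV[R]_n) : Prop :=
  exists p v : 'rV[R]_n, v != 0 /\
    forall t, t \in `]t0, t1[ -> exists s : R, x t = p + s *: v.

Definition projectively_flat : Prop :=
  forall p : M, exists phi : chart R M n,
    [/\ atlas S phi, cdom phi p &
      forall (t0 t1 : R) (c : R -> M), t0 < t1 ->
        geodesic_in phi t0 t1 c -> on_straight_line t0 t1 (chart_coord phi \o c)].

End ProjectiveFlatness.

(* Main.v *)
(* Where F^m does not vanish, the geodesic equation reads m H x'' = S, with H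
   an invertible multiple of the metric g and H y = F^m h_0.  Hence geodesics
   are straight iff S is a multiple of h_0 at each admissible (x, y);
   contracting with y forces the factor to be - y^r h_{00,r}, and this is the
   identity.
   If the identity holds, then x'' = l x', so the direction of x' is constant.
   Conversely a geodesic starts in every admissible direction, by Peano's
   theorem, and its straightness gives the identity at the admissible y; these
   form a nonempty open set and the identity is polynomial in y. *)
Require Import Defs.
From mathcomp Require Import all_boot all_order all_algebra.
From mathcomp Require Import all_classical all_reals all_analysis ring lra.
Import Order.TTheory GRing.Theory Num.Theory numFieldNormedType.Exports.
Set Implicit Arguments.
Unset Strict Implicit.
Unset Printing Implicit Defensive.
Local Open Scope classical_set_scope.
Local Open Scope ring_scope.

(** * Existence of solutions of differential equations *)

(** Geodesics are only twice differentiable, and the position on a straight line is an unspecified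
    function of time. So neither the factor l in x'' = l x' nor that position is ever integrated or
    differentiated: straightness is tested on functions whose derivative vanishes. Solving the
    linear system for x'' gives a field in (x, x') that is continuous where its determinant is
    nonzero, which is just what Peano's theorem asks. Uniqueness of geodesics is never at stake,
    since a single straight geodesic with initial data (x, y) yields the identity at (x, y). That
    geodesic must run on both sides of time 0, where its acceleration is taken. Peano's theorem is
    stated for a bounded field on the whole space, continuous only where the solution passes, so
    that a local field can be cut off by 0. All computations use A = F^m in place of F: dF^2/dy and
    the metric are polynomials in y times powers of F^2 and A. The scalar factors are nonzero where
    A is, so the root drops out of the equations, whatever the sign of A. *)

Lemma ultra_fmap (T U : Type) (g : T -> U) (F : set_system T) :
  UltraFilter F -> UltraFilter (g @ F).
Proof.
move=> UF; have PF : ProperFilter F by exact: ultra_proper.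
split; first exact: fmap_proper_filter.
move=> G PG sG; apply/seteqP; split => // A GA.
have [//|FA] := in_ultra_setVsetC (g @^-1` A) UF.
have GCA : G (~` A) by exact: sG.
have [] := @filter_not_empty _ G _.
by rewrite -(setICr A); exact: filterI.
Qed.

Definition euler (R : realType) (V : normedModType R) (f : V -> V) (z0 : V)
    (h : R) (j : nat) : V :=
  iter j (fun z => z + h *: f z) z0.

(** Each of the [d] steps differs from [h *: c] by at most [h * e], and the errors add up. With
    [c = 0] and [e = C] this bounds the speed; with [c] the value of [f] at a limit point it
    produces the derivative. *)
Lemma euler_increment (R : realType) (V : normedModType R) (f : V -> V)
    (z0 : V) (h : R) (c : V) (e : R) (i d : nat) : 0 <= h ->
  (forall l, (i <= l < i + d)%N -> `|f (euler f z0 h l) - c| <= e) ->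
  `|euler f z0 h (i + d) - euler f z0 h i - (d%:R * h) *: c| <= e * (d%:R * h).
Proof.
move=> h0; elim: d => [|d IH] H.
  by rewrite addn0 mul0r scale0r subrr subr0 normr0 mulr0.
have {}IH : `|euler f z0 h (i + d) - euler f z0 h i - (d%:R * h) *: c|
    <= e * (d%:R * h).
  by apply: IH => l /andP[il ld]; apply: H; rewrite il addnS ltnS ltnW.
have He : `|h *: (f (euler f z0 h (i + d)) - c)| <= h * e.
  rewrite normrZ ger0_norm// ler_wpM2l// H// leq_addr/=.
  by rewrite addnS ltnS.
rewrite addnS [euler _ _ _ (i + d).+1]/(euler f z0 h (i + d) +
  h *: f (euler f z0 h (i + d))).
rewrite [X in `|X|](_ : _ = (euler f z0 h (i + d) - euler f z0 h i - (d%:R * h) *: c)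
   + h *: (f (euler f z0 h (i + d)) - c)); last first.
  rewrite scalerBr -natr1 mulrDl mul1r scalerDl opprD !addrA.
  rewrite -!addrA; congr (_ + _).
  rewrite [LHS]addrC -!addrA; congr (_ + _); congr (_ + _).
  by rewrite addrC.
apply: (le_trans (ler_normD _ _)).
by rewrite -natr1 mulrDl mul1r mulrDr lerD// mulrC.
Qed.

Section PeanoForward.
Context {R : realType} {V : normedModType R}.
Variables (f : V -> V) (C : R) (z0 : V).
Hypothesis fC : forall z, `|f z| <= C.

Let h (k : nat) : R := k.+1%:R^-1.
Let x (k : nat) (t : R) : V := euler f z0 (h k) (Num.truncn (t * k.+1%:R)).

Let C0 : 0 <= C. Proof. exact: le_trans (fC z0). Qed.
Let h0 k : 0 <= h k. Proof. by rewrite invr_ge0. Qed.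

(** Both times are rounded down to the grid of step [h k], so the duration of the [d] steps between
    them is off by at most one step. *)
Let truncn_gap k (s t : R) : 0 <= s -> s <= t ->
  exists2 d : nat, Num.truncn (t * k.+1%:R) = (Num.truncn (s * k.+1%:R) + d)%N
    & `|d%:R * h k - (t - s)| <= h k.
Proof.
move=> s0 st; have t0 := le_trans s0 st.
have k0 : 0 < k.+1%:R :> R by [].
have ij : (Num.truncn (s * k.+1%:R) <= Num.truncn (t * k.+1%:R))%N.
  by apply: le_truncn; rewrite ler_pM2r.
exists (Num.truncn (t * k.+1%:R) - Num.truncn (s * k.+1%:R))%N.
  by rewrite subnKC.
have /andP[s1 s2] := truncn_itv (mulr_ge0 s0 (ltW k0)).
have /andP[t1 t2] := truncn_itv (mulr_ge0 t0 (ltW k0)).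
rewrite -[X in X <= _](mulfK (lt0r_neq0 k0)) -/(h k) ler_piMl ?h0//.
rewrite -[X in _ * X](ger0_norm (ltW k0)) -normrM mulrBl mulfVK ?lt0r_neq0//.
rewrite natrB// mulrBl ler_norml.
move: s1 s2 t1 t2; move: (s * _) (t * _) => u w.
rewrite -[(Num.truncn u).+1%:R]natr1 -[(Num.truncn w).+1%:R]natr1.
lra.
Qed.

(** The term in [h k] is the rounding error of [truncn_gap]; it disappears in the limit over [k]. *)
Let x_increment k (s t : R) (c : V) (e : R) : 0 <= s -> s <= t -> 0 <= e ->
  (forall l, (Num.truncn (s * k.+1%:R) <= l < Num.truncn (t * k.+1%:R))%N ->
    `|f (euler f z0 (h k) l) - c| <= e) ->
  `|x k t - x k s - (t - s) *: c| <= e * (t - s) + (e + `|c|) * h k.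
Proof.
move=> s0 st e0; have [d dE dh] := truncn_gap k s0 st.
rewrite /x dE => /(euler_increment (h0 k)).
set u := euler _ _ _ (_ + _); set w := euler _ _ _ _ => H.
have -> : u - w - (t - s) *: c = (u - w - (d%:R * h k) *: c) +
    (d%:R * h k - (t - s)) *: c.
  by rewrite [(d%:R * _ - _) *: _]scalerBl addrA subrK.
apply: (le_trans (ler_normD _ _)); rewrite normrZ.
have : `|d%:R * h k - (t - s)| * `|c| <= h k * `|c| by rewrite ler_wpM2r.
have : e * (d%:R * h k) <= e * (t - s + h k).
  by rewrite ler_wpM2l//; move: dh; rewrite ler_norml; lra.
lra.
Qed.

(** Every Euler point [l] between the two times is covered, because [x_increment] needs [f] to be
    close to [c] at all of them. *)
Let x_lipschitz k (s t : R) l : 0 <= s -> s <= t ->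
  (Num.truncn (s * k.+1%:R) <= l <= Num.truncn (t * k.+1%:R))%N ->
  `|euler f z0 (h k) l - x k s| <= C * (t - s + h k).
Proof.
move=> s0 st /andP[il lj]; have [d dE dh] := truncn_gap k s0 st.
move: lj; rewrite dE -leq_subLR => ld.
have := @euler_increment _ _ f z0 (h k) 0 C (Num.truncn (s * k.+1%:R))
  (l - Num.truncn (s * k.+1%:R)) (h0 k).
rewrite subnKC// scaler0 subr0 => H.
apply: (le_trans (H _)); first by move=> *; rewrite subr0.
rewrite ler_wpM2l//; apply: (@le_trans _ _ (d%:R * h k)).
  by rewrite ler_wpM2r// ler_nat.
by move: dh; rewrite ler_norml; lra.
Qed.

(* The solution is the pointwise limit, along an ultrafilter on the step sizes,
   of Euler's approximations; this needs no equicontinuity argument, and [f] is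
   only required to be continuous at the values that the limit takes. *)
Lemma peano_forward (Vc : forall r : R, compact [set v : V | `|v| <= r]) :
  exists z : R -> V, [/\ z 0 = z0, forall t, 0 <= t -> `|z t - z0| <= C * t &
    forall s, 0 <= s -> {for z s, continuous f} -> forall e, 0 < e ->
    \forall t \near s, 0 <= t ->
      `|z t - z s - (t - s) *: f (z s)| <= e * `|t - s|].
Proof.
have [U [UU Uoo]] := ultraFilterLemma (@eventually_filter).
have UP : ProperFilter U by exact: ultra_proper.
have x0 k : x k 0 = z0 by rewrite /x mul0r truncn0.
have xb k t : 0 <= t -> `|x k t - z0| <= C * (t + h k).
  move=> t0; rewrite -(x0 k) -[t in X in _ <= X]subr0 x_lipschitz//.
  by rewrite leqnn andbT le_truncn// ler_wpM2r.
have h1 k : h k <= 1 by rewrite invf_le1 ?ltr0n// ler1n.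
have hU : h @ U --> (0 : R).
  by apply: cvg_trans (@cvg_harmonic R); exact: cvg_app.
have xcvg t : 0 <= t -> exists z : V, x^~ t @ U --> z.
  move=> t0; have := Vc (`|z0| + C * (t + 1)).
  rewrite compact_ultra => /(_ (x^~ t @ U)).
  case.
  - exact: ultra_fmap.
  - apply: nearW => k /=; rewrite -[x k t](subrK z0) addrC.
    apply: (le_trans (ler_normD _ _)); rewrite lerD2l.
    by apply: (le_trans (xb k t t0)); rewrite ler_wpM2l// lerD2l.
  - by move=> z [_ zl]; exists z.
have [z zE] : exists z : R -> V, forall t, 0 <= t -> x^~ t @ U --> z t.
  have /choice[z zE] : forall t, exists z : V, 0 <= t -> x^~ t @ U --> z.
    move=> t; have [/xcvg[z]|] := leP 0 t; first by exists z.
    by exists 0.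
  by exists z.
exists z; split.
- have := zE 0 (lexx _); rewrite (_ : x^~ 0 = cst z0); last exact/funext.
  by move/(cvg_unique (@norm_hausdorff _ _)); apply; exact: cvg_cst.
- move=> t t0.
  have H : (fun k => `|x k t - z0| - C * h k) @ U --> `|z t - z0| - C * 0.
    apply: cvgB; last by apply: cvgM hU; exact: cvg_cst.
    by apply: cvg_norm; apply: cvgB; [exact: zE|exact: cvg_cst].
  rewrite mulr0 subr0 in H; rewrite -(cvg_lim _ H)//.
  apply: limr_le; first by apply/cvg_ex; eexists; exact: H.
  by apply: nearW => k; rewrite lerBlDr -mulrDr xb.
move=> s s0 fs e e0.
have /cvgrPdist_le/(_ _ e0) := fs.
rewrite -nbhs_ballE => -[eta /= eta0 feta].
have C1 : 0 < C + 1 by rewrite ltr_wpDl.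
(* Euler points between the times [s] and [t] will lie within [2 * (eta / 8 + eta / 8)] of [x k s],
   itself within [eta / 8] of [z s], which leaves them in the ball of radius [eta]. The factor 2
   serves the case [t < s], where they are reached through [x k t]. Dividing by [C + 1] allows for
   [C = 0]. *)
have eta8 : 0 < eta / 8 by rewrite divr_gt0.
have d0 : 0 < eta / 8 / (C + 1) by rewrite divr_gt0.
near=> t => t0.
have ts : `|t - s| < eta / 8 / (C + 1).
  by rewrite distrC; near: t; exact: (@nbhsx_ballx _ R s _ d0).
have Cts : C * `|t - s| <= eta / 8.
  move: (ltW ts); rewrite ler_pdivlMr// mulrDr mulr1 mulrC => tsC.
  by apply: le_trans tsC; rewrite lerDl.
set c := f (z s).
have key : \forall k \near U,
    `|x k t - x k s - (t - s) *: c| - (e + `|c|) * h k <= e * `|t - s|.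
  near=> k; rewrite lerBlDr.
  have xs : `|z s - x k s| < eta / 8.
    by near: k; move: (zE s s0) => /cvgrPdist_lt; exact.
  have Ch : C * h k <= eta / 8.
    have : `|0 - h k| < eta / 8 / (C + 1).
      by near: k; move: hU => /cvgrPdist_lt; exact.
    rewrite sub0r normrN ger0_norm// => /ltW; rewrite ler_pdivlMr// => hC.
    by apply: le_trans hC; rewrite mulrC ler_wpM2l// lerDl.
  have close l : `|euler f z0 (h k) l - x k s| <= 2 * (C * `|t - s| + C * h k) ->
      `|f (euler f z0 (h k) l) - c| <= e.
    move=> H; rewrite distrC; apply: feta; rewrite -ball_normE /=.
    rewrite -[_ - euler _ _ _ _](subrKA (x k s)).
    apply: (le_lt_trans (ler_normD _ _)); rewrite [`|x k s - _|]distrC; lra.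
  have [st|/ltW ts'] := leP s t.
    rewrite -[X in e * X]ger0_norm ?subr_ge0//; first rewrite normr_id.
    have := @x_increment k s t c e s0 st (ltW e0).
    rewrite (ger0_norm (_ : 0 <= t - s)) ?subr_ge0//; apply=> l /andP[il lj].
    apply: close; apply: le_trans (x_lipschitz s0 st _) _.
      by rewrite il ltnW.
    rewrite ger0_norm ?subr_ge0// -mulrDr; set w := C * _.
    by rewrite mulr_natl mulr2n lerDl mulr_ge0// addr_ge0 ?subr_ge0.
  have -> : x k t - x k s - (t - s) *: c = - (x k s - x k t - (s - t) *: c).
    by rewrite -(opprB s t) scaleNr opprK opprD !opprB opprK.
  rewrite normrN [`|t - s|]distrC (ger0_norm (_ : 0 <= s - t)) ?subr_ge0//.
  apply: x_increment => //; first exact: ltW.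
  move=> l /andP[il lj]; apply: close.
  rewrite -[_ - x k s](subrKA (x k t)); apply: (le_trans (ler_normD _ _)).
  rewrite [`|x k t - x k s|]distrC mulr_natl mulr2n -mulrDr.
  rewrite [`|t - s|]distrC (ger0_norm (_ : 0 <= s - t)) ?subr_ge0// lerD//.
    by apply: x_lipschitz => //; rewrite il ltnW.
  by apply: x_lipschitz => //; rewrite leqnn andbT le_truncn// ler_wpM2r.
have H : (fun k => `|x k t - x k s - (t - s) *: c| - (e + `|c|) * h k) @ U -->
    `|z t - z s - (t - s) *: c| - (e + `|c|) * 0.
  apply: cvgB; last by apply: cvgM hU; exact: cvg_cst.
  apply: cvg_norm; apply: cvgB; last exact: cvg_cst.
  by apply: cvgB; exact: zE.
rewrite mulr0 subr0 in H; rewrite -(cvg_lim _ H)//.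
by apply: limr_le => //; apply/cvg_ex; eexists; exact: H.
Unshelve. all: by end_near.
Qed.
End PeanoForward.

Lemma is_derive_of_near (R : realType) (V : normedModType R) (z : R -> V)
    (s : R) (d : V) :
  (forall e, 0 < e ->
    \forall t \near s, `|z t - z s - (t - s) *: d| <= e * `|t - s|) ->
  is_derive s 1 z d.
Proof.
move=> H.
have L : (fun h => h^-1 *: (z (h *: 1 + s) - z s)) @ 0^' --> d.
  apply/cvgrPdist_le => e e0.
  have Hs : \forall h \near (0 : R), `|z (h + s) - z s - h *: d| <= e * `|h|.
    have := H e e0; rewrite (near_shift 0); apply: filterS => h /=.
    by rewrite subr0 addrK.
  have {}Hs : \forall h \near (0 : R)^', `|z (h + s) - z s - h *: d| <= e * `|h|.
    exact: cvg_within Hs.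
  near=> h.
  have h0 : h != 0 by near: h; exact: nbhs_dnbhs_neq.
  have -> : d - h^-1 *: (z (h *: 1 + s) - z s) =
      - (h^-1 *: (z (h + s) - z s - h *: d)).
    by rewrite [h *: 1]mulr1 [in RHS]scalerBr scalerA mulVf// scale1r opprB.
  rewrite normrN normrZ normfV ler_pdivrMl ?normr_gt0// mulrC.
  by near: h.
by split; [apply/cvg_ex; exists d|exact: cvg_lim L].
Unshelve. all: by end_near.
Qed.

(** The past is the forward solution for [- f] run backwards. At time 0 the two one-sided estimates
    combine into a two-sided derivative. *)
Lemma peano (R : realType) (V : normedModType R)
    (Vc : forall r : R, compact [set v : V | `|v| <= r])
    (f : V -> V) (C : R) (z0 : V) (fC : forall z, `|f z| <= C) :
  exists z : R -> V, [/\ z 0 = z0, forall t, `|z t - z0| <= C * `|t| &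
    forall s, {for z s, continuous f} -> is_derive s 1 z (f (z s))].
Proof.
have gC z : `|- f z| <= C by rewrite normrN.
have [u [u0 uC uf]] := peano_forward z0 fC Vc.
have [w [w0 wC wf]] := peano_forward z0 gC Vc.
pose z t := if 0 <= t then u t else w (- t).
have zu t : 0 <= t -> z t = u t by rewrite /z => ->.
have zw t : t <= 0 -> z t = w (- t).
  move=> t0; rewrite /z; have [t0'|//] := leP 0 t; have -> : t = 0.
    by apply/le_anti; rewrite t0 t0'.
  by rewrite oppr0 u0 w0.
exists z; split; first by rewrite zu.
  move=> t; have [t0|/ltW t0] := leP 0 t.
    by rewrite zu// ger0_norm// uC.
  by rewrite zw// ler0_norm// wC// oppr_ge0.
move=> s fs; apply: is_derive_of_near => e e0.
have Hu : 0 <= s -> \forall t \near s, 0 <= t ->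
    `|z t - z s - (t - s) *: f (z s)| <= e * `|t - s|.
  move=> s0; move: fs; rewrite (zu s)// => fs.
  have := uf s s0 fs e e0; apply: filterS => t H t0.
  by rewrite (zu t)// H.
have Hw : s <= 0 -> \forall t \near s, t <= 0 ->
    `|z t - z s - (t - s) *: f (z s)| <= e * `|t - s|.
  move=> s0; move: fs; rewrite (zw s)// => fs.
  have fs' : {for w (- s), continuous (fun z => - f z)}.
    by apply: continuousN.
  have sN0 : 0 <= - s by rewrite oppr_ge0.
  have opps : (-%R : R -> R) @ s --> - s by exact: opp_continuous.
  have H : \forall t \near s, 0 <= - t ->
      `|w (- t) - w (- s) - (- t - - s) *: - f (w (- s))| <= e * `|- t - - s|.
    exact: opps _ (wf (- s) sN0 fs' e e0).
  apply: filterS H => t H t0.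
  rewrite (zw t)//; move: H; rewrite oppr_ge0 => /(_ t0).
  have -> : - t - - s = - (t - s) by rewrite opprB opprK addrC.
  by rewrite scaleNr scalerN opprK normrN.
have [s0|s0|s0] := ltgtP s 0.
- have := Hw (ltW s0); apply: filterS2 (lt_nbhsl s0) => t t0; apply; exact: ltW.
- have := Hu (ltW s0); apply: filterS2 (lt_nbhsr s0) => t t0; apply; exact: ltW.
- have s1 : 0 <= s by rewrite s0.
  have s2 : s <= 0 by rewrite s0.
  apply: filterS2 (Hu s1) (Hw s2) => t H1 H2.
  by have [/H1|/ltW/H2] := leP 0 t.
Qed.

(** * Contractions of symmetric coefficients *)

Lemma sum_tupleS (R : nmodType) (T : finType) (k m : nat) (F : seq T -> R) :
  m = k.+1 ->
  \sum_(J : m.-tuple T) F J = \sum_i \sum_(J : k.-tuple T) F (i :: J).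
Proof.
move=> ->; rewrite pair_bigA.
rewrite (reindex (fun p : T * k.-tuple T => [tuple of p.1 :: p.2]))//=.
exists (fun J : k.+1.-tuple T => (thead J, [tuple of behead J])).
- by case=> i J _ /=; rewrite theadE; congr (_, _); apply: val_inj.
- by move=> J _; rewrite [RHS]tuple_eta; apply: val_inj.
Qed.

Section Contraction.
Context {R : realType} {n : nat}.
Implicit Types (al : seq 'I_n -> R) (y : 'rV[R]_n) (s : seq 'I_n).

(* The contraction al_{s 0...0} with k zeros. *)
Fixpoint ycontract al k s y : R :=
  if k is k'.+1 then \sum_i y 0 i * ycontract al k' (rcons s i) y else al s.

Lemma ycontract_tuple al k s y :
  ycontract al k s y =
  \sum_(J : k.-tuple 'I_n) al (s ++ J) * \prod_(i <- J) y 0 i.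
Proof.
elim: k s => [|k IH] s.
  rewrite (big_pred1 [tuple])/=; first by rewrite cats0 big_nil mulr1.
  by move=> J; apply/esym/eqP; exact: tuple0.
rewrite (@sum_tupleS _ _ k _ (fun J => al (s ++ J) * \prod_(i <- J) y 0 i))//=.
apply: eq_bigr => i _; rewrite IH mulr_sumr; apply: eq_bigr => J _.
by rewrite cat_rcons big_cons mulrCA.
Qed.

Lemma contract0_ycontract m (a : seq 'I_n -> 'rV[R]_n -> R) s x y :
  Defs.contract0 m a s x y = ycontract (a^~ x) (m - size s) s y.
Proof. by rewrite ycontract_tuple. Qed.

Variable m : nat.

Definition symm_coef al :=
  forall s t, size s = m -> perm_eq s t -> al s = al t.

Lemma ycontract_sym al k s t y : symm_coef al -> (size s + k = m)%N ->
  perm_eq s t -> ycontract al k s y = ycontract al k t y.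
Proof.
move=> alS; elim: k s t => [|k IH] s t /= ms st.
  by apply: alS => //; rewrite -ms addn0.
apply: eq_bigr => i _; congr (_ * _); apply: IH.
  by rewrite size_rcons addSnnS.
by rewrite -!cats1 perm_cat2r.
Qed.

(** This is Leibniz' rule; by symmetry the [k] terms in which a factor [y] is differentiated
    coincide. Coefficients and vector both depend on the parameter, so that one statement covers the
    derivatives in x, in y and along a curve. For [k = 0] the meaningless [k.-1] is multiplied by
    0. *)
Lemma ycontract_derive (E : normedModType R) (z w : E)
    (al : E -> seq 'I_n -> R) (dal : seq 'I_n -> R)
    (v : E -> 'rV[R]_n) (dv : 'rV[R]_n) k s :
  symm_coef (al z) -> (size s + k = m)%N ->
  (forall t, size t = m -> is_derive z w (al^~ t) (dal t)) ->
  (forall i, is_derive z w (fun e => v e 0 i) (dv 0 i)) ->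
  is_derive z w (fun e => ycontract (al e) k s (v e))
   (ycontract dal k s (v z) +
    k%:R * \sum_i dv 0 i * ycontract (al z) k.-1 (rcons s i) (v z)).
Proof.
move=> alS + dalE dvE; elim: k s => [|k IH] s sm /=.
  by rewrite mul0r addr0; apply: dalE; rewrite -sm addn0.
have smS i : (size (rcons s i) + k = m)%N by rewrite size_rcons addSnnS.
rewrite (_ : (fun e => _) = \sum_i (fun e => v e 0 i) *
    (fun e => ycontract (al e) k (rcons s i) (v e))); last first.
  by apply/funext => e; rewrite fct_sumE.
apply: (is_derive_eq
  (is_derive_sum (fun i => is_deriveM (dvE i) (IH _ (smS i))))).
transitivity (\sum_i (v z 0 i * (ycontract dal k (rcons s i) (v z) + k%:R *
    \sum_j dv 0 j * ycontract (al z) k.-1 (rcons (rcons s i) j) (v z)) +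
    ycontract (al z) k (rcons s i) (v z) * dv 0 i) : R) => //.
under [LHS]eq_bigr => i _ do rewrite mulrDr.
rewrite !big_split/= -addrA; congr (_ + _).
rewrite -natr1 mulrDl mul1r; congr (_ + _); last first.
  by apply: eq_bigr => i _; rewrite mulrC.
under eq_bigr do rewrite mulrCA; rewrite -mulr_sumr.
case: k {IH} sm smS => [|k] sm smS; first by rewrite !mul0r.
congr (_ * _); under eq_bigr do rewrite mulr_sumr.
rewrite exchange_big/=; apply: eq_bigr => i _.
rewrite mulr_sumr; apply: eq_bigr => j _; rewrite mulrCA; congr (_ * (_ * _)).
apply: ycontract_sym => //; first by rewrite !size_rcons -sm !addSnnS.
by rewrite -!cats1 -!catA perm_cat2l; apply/permP => p /=; rewrite addnCA.
Qed.

Lemma ycontract_cvg (T : Type) (F : set_system T) {FF : Filter F}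
    (al : T -> seq 'I_n -> R) (al0 : seq 'I_n -> R)
    (v : T -> 'rV[R]_n) (v0 : 'rV[R]_n) k s :
  (size s + k = m)%N ->
  (forall t, size t = m -> al^~ t @ F --> al0 t) ->
  (forall i, (v x 0 i) @[x --> F] --> v0 0 i) ->
  ycontract (al x) k s (v x) @[x --> F] --> ycontract al0 k s v0.
Proof.
move=> + alF vF; elim: k s => [|k IH] s sm /=.
  by apply: alF; rewrite -sm addn0.
apply: cvg_big => [|i _]; first exact: add_continuous.
by apply: cvgM => //; apply: IH; rewrite size_rcons addSnnS.
Qed.

(** Restriction to lines reduces the identity principle for polynomials in [y] to that in one
    variable. *)
Lemma ycontract_poly al k s (y w : 'rV[R]_n) :
  exists p : {poly R}, forall t, ycontract al k s (y + t *: w) = p.[t].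
Proof.
elim: k s => [|k IH] s /=; first by exists (al s)%:P => t; rewrite hornerC.
have /choice[p pE] : forall i, exists p : {poly R},
    forall t, ycontract al k (rcons s i) (y + t *: w) = p.[t] by move=> i; exact: IH.
exists (\sum_i ((y 0 i)%:P + (w 0 i) *: 'X) * p i) => t.
rewrite horner_sum; apply: eq_bigr => i _.
by rewrite pE !hornerE !mxE [t * _]mulrC.
Qed.

End Contraction.

(** * Directional derivatives *)

(** Through this equivalence the chain rules for functions of one real variable apply to directional
    derivatives. *)
Lemma is_derive_line (R : realType) (V W : normedModType R) (f : V -> W)
    (z w : V) (d : W) :
  is_derive z w f d <-> is_derive (0 : R) 1 (fun h => f (h *: w + z)) d.
Proof.
have E : (fun h : R => h^-1 *: (((fun h => f (h *: w + z)) \o shift 0) (h *: 1) -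
      f (0 *: w + z))) = (fun h => h^-1 *: ((f \o shift z) (h *: w) - f z)).
  by apply/funext => h; rewrite /= addr0 [h *: 1]mulr1 scale0r add0r.
split=> -[dv dE]; split.
- by rewrite /derivable E.
- by rewrite -dE /derive E.
- by move: dv; rewrite /derivable E.
- by rewrite -dE /derive E.
Qed.

Lemma is_derive_comp_real (R : realType) (V : normedModType R) (f : V -> R)
    (g : R -> R) (z w : V) (df dg : R) :
  is_derive z w f df -> is_derive (f z) 1 g dg ->
  is_derive z w (g \o f) (dg * df).
Proof.
move=> /is_derive_line df' dg'; apply/is_derive_line.
apply: (@is_derive1_comp _ g (fun h => f (h *: w + z))) => //.
by rewrite scale0r add0r.
Qed.

Lemma is_derive_coord (R : realType) (n : nat) (V : normedModType R)
    (f : V -> 'rV[R]_n) (z w : V) (d : 'rV[R]_n) i :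
  is_derive z w f d -> is_derive z w (fun e => f e 0 i) (d 0 i).
Proof.
move=> [dv <-]; split; first by have /derivable_mxP := dv; exact.
by rewrite derive_mx// mxE.
Qed.

Lemma is_derive_comp_curve (R : realType) (n : nat) (f : 'rV[R]_n -> R)
    (x : R -> 'rV[R]_n) (t : R) (dx : 'rV[R]_n) :
  differentiable f (x t) -> is_derive t 1 x dx ->
  is_derive t 1 (f \o x) (\sum_r dx 0 r * partial r f (x t)).
Proof.
move=> df [/derivable1_diffP dx1 dxE].
have dfx : differentiable (f \o x) t by exact: differentiable_comp.
split; first exact/derivable1_diffP.
rewrite deriveE// diff_comp//= -(deriveE (1 : R^o) dx1) dxE [in LHS](row_sum_delta dx).
rewrite linear_sum; apply: eq_bigr => r _.
by rewrite linearZ /partial deriveE.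
Qed.

(** * Derivatives of the m-th root *)

Section Mroot.
Context {R : realType} (m : nat).
Hypothesis m_gt0 : (0 < m)%N.
Let m0 : m%:R != 0 :> R. Proof. by rewrite pnatr_eq0 -lt0n. Qed.

Lemma mroot_neq0 (z : R) : z != 0 -> mroot m z != 0.
Proof.
move=> z0; rewrite /mroot mulf_neq0 ?sgr_eq0//.
by rewrite gt_eqF// powR_gt0// normr_gt0.
Qed.

(** Written as [mroot m z / (m%:R * z)], the derivative has the same form for both signs of [z],
    which spares a case distinction on the sign of F^m from here on. *)
Lemma is_derive_mroot (z : R) : z != 0 ->
  is_derive z 1 (mroot m) (mroot m z / (m%:R * z)).
Proof.
have powE (w : R) : 0 < w -> m%:R^-1 * w `^ (m%:R^-1 - 1) = w `^ (m%:R^-1) / (m%:R * w).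
  move=> w0; have w1 : w != 0 by rewrite gt_eqF.
  rewrite powRB; last by rewrite w1 implybT.
  by rewrite powRr1 ?ltW//; field; rewrite w1.
move=> z0; have [zlt|zgt|z0'] := ltgtP z 0; last by rewrite z0' eqxx in z0.
- have nz : 0 < - z by rewrite oppr_gt0.
  apply: (@near_eq_is_derive _ _ _ (- (fun w => (- w) `^ (m%:R^-1)))).
    near=> w; have w0 : w < 0 by near: w; exact: lt_nbhsl.
    by rewrite /mroot ltr0_sg// mulN1r ltr0_norm.
  apply: is_derive_eq.
    apply: is_deriveN.
    exact: (is_derive1_comp (is_derive1_powR (m%:R^-1) nz) (is_deriveNid _ _)).
  rewrite powE// /mroot ltr0_sg// ltr0_norm//; field.
  by rewrite z0 m0.
- apply: (@near_eq_is_derive _ _ _ (fun w => w `^ (m%:R^-1))).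
    near=> w; have w0 : 0 < w by near: w; exact: lt_nbhsr.
    by rewrite /mroot gtr0_sg// mul1r gtr0_norm.
  apply: (is_derive_eq (is_derive1_powR _ zgt)).
  by rewrite powE// /mroot gtr0_sg// mul1r gtr0_norm.
Unshelve. all: by end_near.
Qed.

Lemma is_derive_mroot_sqr (V : normedModType R) (f : V -> R) (z w : V) (df : R) :
  f z != 0 -> is_derive z w f df ->
  is_derive z w (fun e => mroot m (f e) ^+ 2)
    (2 * mroot m (f z) ^+ 2 / (m%:R * f z) * df).
Proof.
move=> fz dfz.
have H := is_derive_comp_real dfz (is_deriveX 2 (is_derive_mroot fz)).
apply: (is_derive_eq H).
rewrite -[_ *: _]/(2 * mroot m (f z) ^+ 1 * (mroot m (f z) / (m%:R * f z))).
by rewrite expr1; field; rewrite fz m0.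
Qed.

End Mroot.

(** * Straight curves *)

Lemma cst_of_derive0 (R : realType) (f : R -> R) (t0 t1 : R) :
  (forall t, t \in `]t0, t1[ -> is_derive t 1 f 0) ->
  {in `]t0, t1[ &, forall s t, f s = f t}.
Proof.
move=> df s t; wlog st : s t / s <= t.
  by move=> H sI tI; have [/H|/ltW/H] := leP s t; [apply|move/(_ tI sI)].
move: st; rewrite le_eqVlt => /orP[/eqP -> //|st sI tI].
have I u : s <= u -> u <= t -> u \in `]t0, t1[.
  move=> su ut; move: sI tI; rewrite !in_itv/= => /andP[a b] /andP[c d].
  by rewrite (lt_le_trans a su) (le_lt_trans ut d).
have dI u : u \in `]s, t[ -> is_derive u 1 f (cst 0 u).
  by rewrite in_itv/= => /andP[su ut]; apply/df/I; exact: ltW.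
have cf : {within `[s, t], continuous f}.
  apply: derivable_within_continuous => u; rewrite in_itv/= => /andP[su ut].
  by have [] := df u (I u su ut).
have [c _ /eqP] := MVT st dI cf.
by rewrite mul0r subr_eq0 => /eqP ->.
Qed.

Lemma derive_ratio0 (R : realType) (f g : R -> R) (t l : R) : g t != 0 ->
  is_derive t 1 f (l * f t) -> is_derive t 1 g (l * g t) ->
  is_derive t 1 (fun s => f s / g s) 0.
Proof.
move=> g0 df dg; apply: (is_derive_eq (is_deriveM df (is_deriveV g0 dg))).
by rewrite /GRing.scale/=; field.
Qed.

(* Where v' = l v, the functions v_i v_j / |v|^2 are constant, whatever the
   regularity of l. *)
Lemma straight_of_parallel (R : realType) (n : nat) (x v : R -> 'rV[R]_n) (t0 t1 : R) :
  t0 < t1 ->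
  (forall t, t \in `]t0, t1[ -> [/\ v t != 0, is_derive t 1 x (v t) &
     exists l, is_derive t 1 v (l *: v t)]) ->
  on_straight_line t0 t1 x.
Proof.
move=> t01 H; pose N t := \sum_i v t 0 i ^+ 2.
have Ngt0 t : t \in `]t0, t1[ -> N t != 0.
  move=> /H[v0 _ _]; apply: contra_neq v0 => N0.
  apply/rowP => i; rewrite mxE; apply/eqP; rewrite -sqrf_eq0; move: N0 => /eqP.
  rewrite psumr_eq0; last by move=> j _; exact: sqr_ge0.
  by move=> /allP/(_ i); rewrite mem_index_enum => /(_ isT)/implyP; exact.
have ratio i j : {in `]t0, t1[ &, forall s t,
    v s 0 i * v s 0 j / N s = v t 0 i * v t 0 j / N t}.
  apply: (@cst_of_derive0 _ (fun t => v t 0 i * v t 0 j / N t)) => t tI.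
  have [_ _ [l dv]] := H t tI.
  have dvi k : is_derive t 1 (fun s => v s 0 k) (l * v t 0 k).
    by have := is_derive_coord k dv; rewrite mxE.
  have dnum : is_derive t 1 (fun s => v s 0 i * v s 0 j)
      (2 * l * (v t 0 i * v t 0 j)).
    apply: (is_derive_eq (is_deriveM (dvi i) (dvi j))).
    by rewrite /GRing.scale/=; ring.
  have dN : is_derive t 1 N (2 * l * N t).
    rewrite {1}(_ : N = \sum_i (fun s => v s 0 i) ^+ 2); last first.
      by apply/funext => s; rewrite fct_sumE.
    apply: (is_derive_eq (is_derive_sum (fun k => is_deriveX 2 (dvi k)))).
    rewrite mulr_sumr; apply: eq_bigr => k _.
    by rewrite -[LHS]/(2 * v t 0 k ^+ 1 * (l * v t 0 k)); ring.
  exact: (derive_ratio0 (Ngt0 t tI) dnum dN).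
pose s := (t0 + t1) / 2.
have sI : s \in `]t0, t1[ by rewrite in_itv/=; apply/andP; rewrite /s; split; lra.
pose u := v s.
have u0 : u != 0 by have [] := H s sI.
have par t i j : t \in `]t0, t1[ -> v t 0 i * u 0 j = v t 0 j * u 0 i.
  move=> tI; have Nt := Ngt0 t tI; have Ns := Ngt0 s sI.
  (* The matrix [v_k v_l / N] is the orthogonal projection onto the line of [v]. Applying the equal
     projections at times [t] and [s] to [u = v s] gives [c v_k = N u_k], which makes [v t] parallel
     to [u]. *)
  pose c := \sum_k v t 0 k * u 0 k.
  have vc k : v t 0 k * c = u 0 k * N t.
    have : \sum_l (v t 0 k * v t 0 l / N t * u 0 l) * N t =
        \sum_l (u 0 k * u 0 l / N s * u 0 l) * N t.
      by apply: eq_bigr => l _; rewrite (ratio k l t s).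
    have -> : \sum_l (v t 0 k * v t 0 l / N t * u 0 l) * N t = v t 0 k * c.
      by rewrite /c mulr_sumr; apply: eq_bigr => l _; field.
    move=> ->; rewrite -mulr_suml; congr (_ * _).
    transitivity (u 0 k / N s * N s); last by field.
    by rewrite [X in _ = _ * X]/N mulr_sumr; apply: eq_bigr => l _; rewrite -/u; field.
  have c0 : c != 0.
    apply: contra_neq u0 => c0; apply/rowP => k; rewrite mxE.
    have := vc k; rewrite c0 mulr0 => /esym/eqP.
    by rewrite mulf_eq0 (negPf Nt) orbF => /eqP.
  apply: (mulIf c0); rewrite mulrAC vc [RHS]mulrAC vc; ring.
have [j uj] : exists j, u 0 j != 0.
  apply/existsP; apply: contra_neqT u0; rewrite negb_exists => /forallP u0.
  by apply/rowP => k; rewrite mxE; apply/eqP; have := u0 k; rewrite negbK.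
have xc i : {in `]t0, t1[ &, forall s t,
    u 0 j * x s 0 i - u 0 i * x s 0 j = u 0 j * x t 0 i - u 0 i * x t 0 j}.
  apply: (@cst_of_derive0 _ (fun t => u 0 j * x t 0 i - u 0 i * x t 0 j)) => t tI.
  have [_ dx _] := H t tI.
  apply: (is_derive_eq (is_deriveB (is_deriveZ (u 0 j) (is_derive_coord i dx))
     (is_deriveZ (u 0 i) (is_derive_coord j dx)))).
  by rewrite /GRing.scale/= mulrC par// mulrC subrr.
exists (x s), u; split => // t tI.
exists ((x t 0 j - x s 0 j) / u 0 j); apply/rowP => i; rewrite !mxE.
have := xc i t s tI sI => E.
apply: (mulfI uj); rewrite mulrDr mulrA [X in _ + X * _]mulrCA mulfV// mulr1.
by move: E => /eqP; rewrite subr_eq => /eqP ->; ring.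
Qed.

(** With [u] the direction of the line and [u_j] nonzero, the functionals [u_j x_i - u_i x_j] are
    constant along the curve, however the line is traversed. Differentiating them twice shows that
    [v 0] and [acc] are multiples of [u], and [v 0] is nonzero. *)
Lemma parallel_of_straight (R : realType) (n : nat) (x v : R -> 'rV[R]_n)
    (T : R) (acc : 'rV[R]_n) :
  0 < T -> (forall t, t \in `]- T, T[ -> is_derive t 1 x (v t)) ->
  is_derive (0 : R) 1 v acc -> v 0 != 0 -> on_straight_line (- T) T x ->
  exists l, acc = l *: v 0.
Proof.
move=> T0 dx dv v0 [p [u [u0 line]]].
have I0 : 0 \in `]- T, T[ by rewrite in_itv/= oppr_lt0 T0.
have [j uj] : exists j, u 0 j != 0.
  apply/existsP; apply: contra_neqT u0; rewrite negb_exists => /forallP u0.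
  by apply/rowP => k; rewrite mxE; apply/eqP; have := u0 k; rewrite negbK.
have dxu (y : R -> 'rV[R]_n) (t : R) (d : 'rV[R]_n) i : is_derive t 1 y d ->
    is_derive t 1 (fun s => u 0 j * y s 0 i - u 0 i * y s 0 j)
      (u 0 j * d 0 i - u 0 i * d 0 j).
  move=> dy; exact: (is_deriveB (is_deriveZ (u 0 j) (is_derive_coord i dy))
     (is_deriveZ (u 0 i) (is_derive_coord j dy))).
have nearI (t : R) : t \in `]- T, T[ -> \forall s \near t, s \in `]- T, T[.
  exact: near_in_itvoo.
have par t i : t \in `]- T, T[ -> u 0 j * v t 0 i - u 0 i * v t 0 j = 0.
  move=> tI; have D := dxu _ _ _ i (dx t tI).
  have E : \forall s \near t, u 0 j * x s 0 i - u 0 i * x s 0 j =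
      cst (u 0 j * p 0 i - u 0 i * p 0 j) s.
    apply: filterS (nearI t tI) => s /line[k ->]; rewrite !mxE /=; ring.
  have := near_eq_is_derive E D => /@derive_val <-.
  exact: derive_cst.
have par2 i : u 0 j * acc 0 i - u 0 i * acc 0 j = 0.
  have D := dxu _ _ _ i dv.
  have E : \forall s \near (0 : R), u 0 j * v s 0 i - u 0 i * v s 0 j = cst 0 s.
    by apply: filterS (nearI 0 I0) => s /par ->.
  have := near_eq_is_derive E D => /@derive_val <-.
  exact: derive_cst.
have vE i : v 0 0 i = v 0 0 j / u 0 j * u 0 i.
  by apply: (mulfI uj); have /eqP := par 0 i I0; rewrite subr_eq0 => /eqP ->; field.
have accE i : acc 0 i = acc 0 j / u 0 j * u 0 i.
  by apply: (mulfI uj); have /eqP := par2 i; rewrite subr_eq0 => /eqP ->; field.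
have vj : v 0 0 j != 0.
  apply: contra_neq v0 => vj; apply/rowP => i.
  by rewrite vE vj !mul0r mxE.
exists (acc 0 j / v 0 0 j); apply/rowP => i; rewrite mxE (accE i) (vE i).
by field; rewrite vj uj.
Qed.

(** * Products, compactness and limits *)

Lemma is_derive_cvg (R : realType) (V : normedModType R) (z : R -> V) (t : R) (d : V) :
  is_derive t 1 z d <->
  (fun h => h^-1 *: (z (h *: 1 + t) - z t)) @ 0^' --> d.
Proof.
split=> [[dz <-]|L]; first exact: dz.
by split; [apply/cvg_ex; exists d|exact: cvg_lim L].
Qed.

Lemma is_derive_fst (R : realType) (V W : normedModType R) (z : R -> V * W)
    (t : R) (d : V * W) :
  is_derive t 1 z d -> is_derive t 1 (fun s => (z s).1) d.1.
Proof.
case: d => d1 d2 /is_derive_cvg L; apply/is_derive_cvg.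
exact: (cvg_comp (fun h : R => h^-1 *: (z (h *: 1 + t) - z t)) fst L cvg_fst).
Qed.

Lemma is_derive_snd (R : realType) (V W : normedModType R) (z : R -> V * W)
    (t : R) (d : V * W) :
  is_derive t 1 z d -> is_derive t 1 (fun s => (z s).2) d.2.
Proof.
case: d => d1 d2 /is_derive_cvg L; apply/is_derive_cvg.
exact: (cvg_comp (fun h : R => h^-1 *: (z (h *: 1 + t) - z t)) snd L cvg_snd).
Qed.

Lemma compact_ball_rV (R : realType) (n : nat) (r : R) :
  compact [set v : 'rV[R]_n | `|v| <= r].
Proof.
apply: bounded_closed_compact.
  by exists r; split; [exact: num_real|move=> M rM v /= /le_trans; apply; exact: ltW].
apply: (@closed_comp _ _ (fun v : 'rV[R]_n => `|v|) [set u | u <= r]).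
  by move=> v _; exact: norm_continuous.
exact: closed_le.
Qed.

Lemma compact_ball_prod (R : realType) (V W : normedModType R) (r : R) :
  compact [set v : V | `|v| <= r] -> compact [set w : W | `|w| <= r] ->
  compact [set z : V * W | `|z| <= r].
Proof.
move=> cV cW; have := compact_setX cV cW; congr compact.
apply/seteqP; split=> z /=.
  by move=> [z1 z2]; rewrite prod_normE ge_max z1.
by rewrite prod_normE ge_max => /andP[].
Qed.

Lemma det_cvg (R : realType) (T : Type) (F : set_system T) {FF : Filter F}
    (n : nat) (A : T -> 'M[R]_n) (A0 : 'M[R]_n) :
  (forall i j, A e i j @[e --> F] --> A0 i j) ->
  \det (A e) @[e --> F] --> \det A0.
Proof.
move=> AF; apply: cvg_big => [|s _]; first exact: add_continuous.
apply: cvgM; first exact: cvg_cst.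
by apply: cvg_big => [|i _]; [exact: mul_continuous|exact: AF].
Qed.

Lemma adj_cvg (R : realType) (T : Type) (F : set_system T) {FF : Filter F}
    (n : nat) (A : T -> 'M[R]_n) (A0 : 'M[R]_n) i j :
  (forall i j, A e i j @[e --> F] --> A0 i j) ->
  (\adj (A e)) i j @[e --> F] --> (\adj A0) i j.
Proof.
move=> AF; under [fun e => _]funext do rewrite mxE.
rewrite mxE /cofactor; apply: cvgM; first exact: cvg_cst.
by apply: det_cvg => k l; under [fun e => _]funext do rewrite !mxE; rewrite !mxE; exact: AF.
Qed.

Lemma cvg_row (R : realType) (T : Type) (F : set_system T) {FF : Filter F}
    (n : nat) (f : T -> 'rV[R]_n) (l : 'rV[R]_n) :
  (forall i, f e 0 i @[e --> F] --> l 0 i) -> f @ F --> l.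
Proof.
move=> fF; apply/cvgrPdist_le => e e0; near=> t.
rewrite /Num.Def.normr/= mx_normrE (bigmax_le _ (ltW e0))//= => -[i j] _.
rewrite !mxE/= (ord1 i); move: j; near: t; apply: filter_forall => j.
by have /cvgrPdist_le := fF j; exact.
Unshelve. all: by end_near.
Qed.

(** The points [e / k.+2] with [k < size p] are too many distinct roots for a nonzero [p]; starting
    the denominators at 2 keeps them strictly inside the ball. *)
Lemma poly_near0 (R : realType) (p : {poly R}) :
  (\forall t \near (0 : R), p.[t] = 0) -> p = 0.
Proof.
move=> /nbhs_ballP[e /= e0 pe].
apply: (@roots_geq_poly_eq0 _ _ [seq e / k.+2%:R | k <- iota 0 (size p)]).
- apply/allP => _ /mapP[k _ ->]; apply/eqP/pe.
  rewrite -ball_normE /= sub0r normrN gtr0_norm ?divr_gt0//.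
  by rewrite ltr_pdivrMr// ltr_pMr// ltr1n.
- rewrite map_inj_uniq ?iota_uniq// => k l /(mulfI (lt0r_neq0 e0))/invr_inj/eqP.
  by rewrite eqr_nat => /eqP[].
- by rewrite size_map size_iota.
Qed.

(** * The geodesic equation of an m-th root metric *)

Lemma ycontract_sum (R : realType) (n : nat) (I : Type) (r : seq I) (c : I -> R)
    (al : I -> seq 'I_n -> R) k s (y : 'rV[R]_n) :
  ycontract (fun t => \sum_(i <- r) c i * al i t) k s y =
  \sum_(i <- r) c i * ycontract (al i) k s y.
Proof.
elim: k s => [//|k IH] s /=.
transitivity (\sum_l \sum_(i <- r) y 0 l * (c i * ycontract (al i) k (rcons s l) y)).
  by apply: eq_bigr => l _; rewrite IH mulr_sumr.
rewrite exchange_big/=; apply: eq_bigr => i _; rewrite mulr_sumr.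
by apply: eq_bigr => l _; rewrite mulrCA.
Qed.

Lemma sum_delta_mx (R : realType) (n : nat) (i : 'I_n) (F : 'I_n -> R) :
  \sum_j (delta_mx 0 i : 'rV[R]_n) 0 j * F j = F i.
Proof.
rewrite (bigD1 i)//= mxE !eqxx mul1r big1 ?addr0// => j ji.
by rewrite mxE eqxx (negPf ji) mul0r.
Qed.

Section Metric.
Context {R : realType} {n m : nat}.
Variables (a : seq 'I_n -> 'rV[R]_n -> R) (U : set 'rV[R]_n).
Hypotheses (m_ge2 : (2 <= m)%N) (oU : open U).
Hypothesis aC1 : forall s, size s = m -> Ck 1 U (a s).
Hypothesis aS : forall x, U x -> symm_coef m (a^~ x).

Implicit Types x y : 'rV[R]_n.

(* In the notation of the paper: hform = h_00 = F^m, hform1 i = h_i0,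
   hform2 i j = h_ij, hformx r = h_{00,r}, hform1x r i = h_{i0,r}, and hform0,
   hform10 are the contractions of the last two with y^r. *)
Definition hform x y := ycontract (a^~ x) m [::] y.
Definition hform1 i x y := ycontract (a^~ x) m.-1 [:: i] y.
Definition hform2 i j x y := ycontract (a^~ x) m.-2 [:: i; j] y.
Definition dcoef r (x : 'rV[R]_n) s := partial r (a s) x.
Definition hformx r x y := ycontract (dcoef r x) m [::] y.
Definition hform1x r i x y := ycontract (dcoef r x) m.-1 [:: i] y.
Definition hform0 x y := \sum_r y 0 r * hformx r x y.
Definition hform10 i x y := \sum_r y 0 r * hform1x r i x y.

Let mE1 : m = m.-1.+1. Proof. by case: m m_ge2. Qed.
Let mE2 : m.-1 = m.-2.+1. Proof. by case: m m_ge2 => [|[]]. Qed.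
Let m_gt0 : (0 < m)%N. Proof. exact: ltnW. Qed.
Let m0 : m%:R != 0 :> R. Proof. by rewrite pnatr_eq0 -lt0n. Qed.
Let m1 : (m%:R - 1) != 0 :> R.
Proof. by rewrite subr_eq0 (eqr_nat _ m 1) gtn_eqF. Qed.
Let m1E : m.-1%:R = m%:R - 1 :> R.
Proof. by rewrite {2}mE1 -natr1 addrK. Qed.

Lemma h00E x y : h00 m a x y = hform x y.
Proof. by rewrite /h00 contract0_ycontract subn0. Qed.

Lemma h0E i x y : h0 m a i x y = hform1 i x y.
Proof. by rewrite /h0 contract0_ycontract subn1. Qed.

Let a_derive s x w : size s = m -> U x ->
  is_derive x w (a s) (\sum_r w 0 r * dcoef r x s).
Proof.
move=> sm Ux; have [da _] := aC1 sm; have {}da := da _ Ux.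
apply/is_derive_line.
have dl : is_derive (0 : R) 1 (fun h : R => h *: w + x) w.
  apply/(is_derive_line (fun z => z)); exact: is_derive_id.
have := @is_derive_comp_curve R n (a s) (fun h : R => h *: w + x) 0 w.
by rewrite scale0r add0r; apply.
Qed.

Lemma hform_euler x y : hform x y = \sum_i y 0 i * hform1 i x y.
Proof. by rewrite /hform {1}mE1. Qed.

Lemma hformx_euler r x y : hformx r x y = \sum_i y 0 i * hform1x r i x y.
Proof. by rewrite /hformx {1}mE1. Qed.

Lemma hform1_euler i x y : hform1 i x y = \sum_j y 0 j * hform2 i j x y.
Proof. by rewrite /hform1 {1}mE2. Qed.

Lemma hform2C i j x y : U x -> hform2 i j x y = hform2 j i x y.
Proof.
move=> Ux; rewrite /hform2; apply: (ycontract_sym _ (aS Ux)).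
  by rewrite [RHS]mE1 mE2.
by apply/permP => p /=; rewrite addnCA.
Qed.

Section Derivatives.
Variables (E : normedModType R) (z w : E) (x y : E -> 'rV[R]_n).
Variables (dx dy : 'rV[R]_n).
Hypothesis (Ux : U (x z)).
Hypothesis dxs : forall s, size s = m ->
  is_derive z w (fun e => a s (x e)) (\sum_r dx 0 r * dcoef r (x z) s).
Hypothesis dys : forall i, is_derive z w (fun e => y e 0 i) (dy 0 i).

Lemma is_derive_hform : is_derive z w (fun e => hform (x e) (y e))
  (\sum_r dx 0 r * hformx r (x z) (y z) +
   m%:R * \sum_i dy 0 i * hform1 i (x z) (y z)).
Proof.
have := ycontract_derive (k := m) (s := [::]) (al := fun e => a^~ (x e))
  (aS Ux) erefl dxs dys.
by rewrite ycontract_sum.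
Qed.

Lemma is_derive_hform1 i : is_derive z w (fun e => hform1 i (x e) (y e))
  (\sum_r dx 0 r * hform1x r i (x z) (y z) +
   (m%:R - 1) * \sum_j dy 0 j * hform2 i j (x z) (y z)).
Proof.
have := ycontract_derive (k := m.-1) (s := [:: i]) (al := fun e => a^~ (x e))
  (aS Ux) (esym mE1) dxs dys.
by rewrite ycontract_sum m1E.
Qed.
End Derivatives.

Let dx_cst (x y w : 'rV[R]_n) s : size s = m ->
  is_derive y w (fun=> a s x) (\sum_r (0 : 'rV[R]_n) 0 r * dcoef r x s).
Proof.
move=> _; rewrite big1; first exact: is_derive_cst.
by move=> r _; rewrite mxE mul0r.
Qed.

Let dx_id (x w : 'rV[R]_n) s : U x -> size s = m ->
  is_derive x w (fun e => a s e) (\sum_r w 0 r * dcoef r x s).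
Proof. by move=> Ux sm; exact: a_derive. Qed.

Let dy_id (y w : 'rV[R]_n) i : is_derive y w (fun e : 'rV[R]_n => e 0 i) (w 0 i).
Proof. exact: (is_derive_coord i (is_derive_id y w)). Qed.

Let dy_cst (x y w : 'rV[R]_n) i : is_derive x w (fun=> y 0 i) ((0 : 'rV[R]_n) 0 i).
Proof. by rewrite mxE; exact: is_derive_cst. Qed.

Let sum0 (F : 'I_n -> R) : \sum_i (0 : 'rV[R]_n) 0 i * F i = 0.
Proof. by rewrite big1// => i _; rewrite mxE mul0r. Qed.

Lemma hform_dy x y i : U x ->
  is_derive y (delta_mx 0 i) (hform x) (m%:R * hform1 i x y).
Proof.
move=> Ux; have := is_derive_hform (z := y) (w := delta_mx 0 i)
  (x := fun=> x) (y := id) Ux (dx_cst x _ _) (dy_id _ _).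
by rewrite sum0 add0r sum_delta_mx.
Qed.

Lemma hform1_dy x y i j : U x ->
  is_derive y (delta_mx 0 j) (hform1 i x) ((m%:R - 1) * hform2 i j x y).
Proof.
move=> Ux.
have := is_derive_hform1 (z := y) (w := delta_mx 0 j)
  (x := fun=> x) (y := id) Ux (dx_cst x _ _) (dy_id _ _) i.
by rewrite sum0 add0r sum_delta_mx.
Qed.

Lemma hform_dx x y i : U x -> is_derive x (delta_mx 0 i) (hform^~ y) (hformx i x y).
Proof.
move=> Ux.
have := is_derive_hform (z := x) (w := delta_mx 0 i)
  (x := id) (y := fun=> y) Ux (fun s => @dx_id x _ s Ux) (dy_cst x y _).
by rewrite sum0 mulr0 addr0 sum_delta_mx.
Qed.

Lemma h00xE r x y : U x -> h00x m a r x y = hformx r x y.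
Proof.
move=> Ux; rewrite /h00x (_ : (fun z => _) = hform^~ y).
  by rewrite /partial; have := hform_dx y r Ux => /@derive_val.
by apply/funext => z; rewrite h00E.
Qed.

(** The product of the [y]'s is invariant under rotation of [J], so reindexing by the rotation makes
    the [m] terms of the cyclic sum equal. *)
Lemma gamma0E j x y :
  m%:R * (m%:R - 1) * gamma0 m a j x y = m%:R * hform10 j x y - hformx j x y.
Proof.
transitivity (\sum_(J : m.-tuple 'I_n)
   (\sum_(k < m) partial (tnth J k) (a (j :: behead (rot k J))) x
    - partial j (a J) x) * \prod_(i <- J) y 0 i).
  rewrite mulr_sumr; apply: eq_bigr => J _.
  by rewrite /gamma mulrA (mulrA _ (_^-1)) mulfV ?mul1r// mulf_neq0.
under eq_bigr do rewrite mulrBl; rewrite sumrB; congr (_ - _); last first.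
  by rewrite /hformx ycontract_tuple.
under eq_bigr do rewrite mulr_suml; rewrite exchange_big/=.
transitivity (\sum_(k < m) hform10 j x y); last first.
  by rewrite sumr_const card_ord mulr_natl.
apply: eq_bigr => k _.
(* The value 0 on the empty list is a filler: [J] has length [m > 0]. *)
transitivity (\sum_(J : m.-tuple 'I_n)
    (if (J : seq _) is i :: J' then partial i (a (j :: J')) x else 0) *
    \prod_(i <- J) y 0 i).
  rewrite [RHS](reindex (fun J : m.-tuple 'I_n => rot_tuple k J))/=; last first.
    exists (fun J : m.-tuple 'I_n => rotr_tuple k J) => J _;
      by apply: val_inj; rewrite /= ?rotK ?rotrK.
  apply: eq_bigr => J _; congr (_ * _); last by apply: perm_big; rewrite perm_sym perm_rot.
  have E : rot k J = tnth J k :: behead (rot k J).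
    by rewrite /rot (drop_nth (tnth J k)) ?size_tuple//= -tnth_nth.
  by rewrite /= [in RHS]E.
rewrite (@sum_tupleS _ _ m.-1 _ (fun J =>
  (if J is i :: J' then partial i (a (j :: J')) x else 0) * \prod_(i <- J) y 0 i))//.
rewrite /hform10; apply: eq_bigr => i _.
rewrite /hform1x ycontract_tuple mulr_sumr; apply: eq_bigr => J _.
by rewrite big_cons mulrCA.
Qed.

Lemma a_cvg (T : Type) (F : set_system T) {FF : Filter F} (x : T -> 'rV[R]_n)
    x0 s : U x0 -> size s = m -> x @ F --> x0 -> a s (x e) @[e --> F] --> a s x0.
Proof.
move=> Ux sm xF; have [/(_ _ Ux) da _] := aC1 sm.
exact: cvg_comp xF (differentiable_continuous da).
Qed.

Lemma dcoef_cvg (T : Type) (F : set_system T) {FF : Filter F}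
    (x : T -> 'rV[R]_n) x0 r s : U x0 -> size s = m -> x @ F --> x0 ->
  dcoef r (x e) s @[e --> F] --> dcoef r x0 s.
Proof.
move=> Ux sm xF; have [_ /(_ (delta_mx 0 r) x0 Ux) da] := aC1 sm.
exact: cvg_comp xF da.
Qed.

Section Continuity.
Variables (T : Type) (F : set_system T) (FF : Filter F).
Variables (x y : T -> 'rV[R]_n) (x0 y0 : 'rV[R]_n).
Hypotheses (Ux0 : U x0) (xF : x @ F --> x0) (yF : y @ F --> y0).

Let yFi i : y e 0 i @[e --> F] --> y0 0 i.
Proof. exact: cvg_comp yF (@coord_continuous _ _ _ _ _ _). Qed.

Let aF s : size s = m -> a s (x e) @[e --> F] --> a s x0.
Proof. by move=> sm; exact: a_cvg. Qed.

Let daF r s : size s = m -> dcoef r (x e) s @[e --> F] --> dcoef r x0 s.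
Proof. by move=> sm; exact: dcoef_cvg. Qed.

Lemma hform_cvg : hform (x e) (y e) @[e --> F] --> hform x0 y0.
Proof. exact: (ycontract_cvg (s := [::]) (k := m) erefl aF yFi). Qed.

Lemma hform1_cvg i : hform1 i (x e) (y e) @[e --> F] --> hform1 i x0 y0.
Proof. exact: (ycontract_cvg (s := [:: i]) (k := m.-1) (esym mE1) aF yFi). Qed.

Lemma hform2_cvg i j : hform2 i j (x e) (y e) @[e --> F] --> hform2 i j x0 y0.
Proof.
have m2 : (size [:: i; j] + m.-2 = m)%N by rewrite [RHS]mE1 mE2.
exact: (ycontract_cvg (s := [:: i; j]) (k := m.-2) m2 aF yFi).
Qed.

Lemma hformx_cvg r : hformx r (x e) (y e) @[e --> F] --> hformx r x0 y0.
Proof.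
have H := @ycontract_cvg _ _ m _ _ FF (fun e => dcoef r (x e)) (dcoef r x0) y y0 m [::] erefl.
by apply: H => [s|]; [exact: daF|exact: yFi].
Qed.

Lemma hform1x_cvg r i : hform1x r i (x e) (y e) @[e --> F] --> hform1x r i x0 y0.
Proof.
have H := @ycontract_cvg _ _ m _ _ FF (fun e => dcoef r (x e)) (dcoef r x0) y y0
  m.-1 [:: i] (esym mE1).
by apply: H => [s|]; [exact: daF|exact: yFi].
Qed.

Lemma hform0_cvg : hform0 (x e) (y e) @[e --> F] --> hform0 x0 y0.
Proof.
apply: cvg_big => [|r _]; first exact: add_continuous.
by apply: cvgM; [exact: yFi|exact: hformx_cvg].
Qed.

Lemma hform10_cvg i : hform10 i (x e) (y e) @[e --> F] --> hform10 i x0 y0.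
Proof.
apply: cvg_big => [|r _]; first exact: add_continuous.
by apply: cvgM; [exact: yFi|exact: hform1x_cvg].
Qed.

Lemma near_hform_neq0 : hform x0 y0 != 0 -> \forall e \near F, hform (x e) (y e) != 0.
Proof. exact: cvgr_neq0 hform_cvg. Qed.

End Continuity.

(** * The metric and the Euler-Lagrange equations in terms of F^m *)

Lemma FmE x y : Fm m a x y = mroot m (hform x y).
Proof. by rewrite /Fm h00E. Qed.

Lemma partial_y_Fm_sqr i x y : U x -> hform x y != 0 ->
  partial i (fun w => Fm m a x w ^+ 2) y =
  2 * mroot m (hform x y) ^+ 2 / hform x y * hform1 i x y.
Proof.
move=> Ux A0; under [fun w => _]funext do rewrite FmE.
have := is_derive_mroot_sqr m_gt0 A0 (hform_dy y i Ux).
by rewrite /partial => /@derive_val ->; field; rewrite A0.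
Qed.

Lemma partial_x_Fm_sqr i x y : U x -> hform x y != 0 ->
  partial i (fun z => Fm m a z y ^+ 2) x =
  2 * mroot m (hform x y) ^+ 2 / (m%:R * hform x y) * hformx i x y.
Proof.
move=> Ux A0; under [fun w => _]funext do rewrite FmE.
have := is_derive_mroot_sqr (f := hform^~ y) (z := x) m_gt0 A0 (hform_dx y i Ux).
by move=> /@derive_val.
Qed.

(* The metric g, freed from its factor F^2 / (F^m)^2; see [gmxE]. *)
Definition hess i j x y :=
  (2 - m%:R) * (hform1 i x y * hform1 j x y) +
  (m%:R - 1) * (hform x y * hform2 i j x y).

(* For A = F^m and H = h_i0, the differentiated function is the momentum
   dF^2/dy^i. *)
Lemma is_derive_legendre (E : normedModType R) (A H : E -> R) (z w : E) (dA dH : R) :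
  A z != 0 -> is_derive z w A dA -> is_derive z w H dH ->
  is_derive z w (fun e => 2 * mroot m (A e) ^+ 2 / A e * H e)
   (2 * mroot m (A z) ^+ 2 / (m%:R * A z ^+ 2) *
    ((2 - m%:R) * dA * H z + m%:R * A z * dH)).
Proof.
move=> A0 dA' dH'.
have H1 := is_derive_mroot_sqr m_gt0 A0 dA'.
have inv' : is_derive (A z) 1 (fun u : R => u^-1) (- A z ^- 2).
  apply: (is_derive_eq (is_deriveV (f := id) A0 (is_derive_id _ _))).
  by rewrite /GRing.scale/= mulr1.
have H2 := is_derive_comp_real dA' inv'.
rewrite (_ : (fun e => _) =
    (2 \*: ((fun e => mroot m (A e) ^+ 2) * ((fun u => u^-1) \o A))) * H).
  apply: (is_derive_eq (is_deriveM (is_deriveZ 2 (is_deriveM H1 H2)) dH')).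
  rewrite /GRing.scale/=.
  transitivity (2 * (mroot m (A z) ^+ 2 * (A z)^-1) * dH + H z * (2 *
    (mroot m (A z) ^+ 2 * (- A z ^- 2 * dA) +
     (A z)^-1 * (2 * mroot m (A z) ^+ 2 / (m%:R * A z) * dA)))) => //.
  by field; rewrite A0 m0.
by apply/funext => e; rewrite -[RHS]/(2 * (_ / _) * _) mulrA.
Qed.

Lemma gmxE x y : U x -> hform x y != 0 ->
  gmx m a x y = (mroot m (hform x y) ^+ 2 / hform x y ^+ 2) *:
    \matrix_(i, j) hess i j x y.
Proof.
move=> Ux A0; apply/matrixP => i j; rewrite !mxE.
(* The formula for dF^2/dy^j holds only where F^m is nonzero; this is so near [y], which is enough
   to differentiate once more. *)
have E : \forall w \near y, 2 * mroot m (hform x w) ^+ 2 / hform x w * hform1 j x w =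
    partial j (fun z => Fm m a x z ^+ 2) w.
  have : \forall w \near y, hform x w != 0.
    by apply: (near_hform_neq0 (F := nbhs y) (x := fun=> x) (y := id) _ Ux _ _ A0);
      [exact: cvg_cst|exact: cvg_id].
  by apply: filterS => w Aw; rewrite partial_y_Fm_sqr.
have D := is_derive_legendre A0 (hform_dy y i Ux) (hform1_dy y j i Ux).
rewrite {1}/partial (@derive_val _ _ _ _ _ _ _ (near_eq_is_derive E D)).
by rewrite (hform2C _ _ _ Ux) /hess; field; rewrite A0 m0.
Qed.

(** The vector S of the equation m H x'' = S. Its index is lowered: the classical spray coefficients
    arise, up to a factor, by inverting [hess]. *)
Definition spray i x y :=
  hform x y * hformx i x y - (2 - m%:R) * hform0 x y * hform1 i x y -
  m%:R * hform x y * hform10 i x y.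

(** With A = F^m, both sides are multiplied by [m A^2 / (2 F^2)], which is nonzero and removes the
    root. The terms containing [acc] then assemble into [hess], and the others into [spray]. *)
Lemma euler_lagrangeE (x v : R -> 'rV[R]_n) (t : R) (acc : 'rV[R]_n) i :
  is_derive t 1 x (v t) -> is_derive t 1 v acc -> U (x t) ->
  hform (x t) (v t) != 0 ->
  is_derive t 1 (fun s => partial i (fun y => Fm m a (x s) y ^+ 2) (v s))
     (partial i (fun z => Fm m a z (v t) ^+ 2) (x t)) <->
  m%:R * \sum_j acc 0 j * hess i j (x t) (v t) = spray i (x t) (v t).
Proof.
move=> dx dv Ux A0.
have cx : x @ t --> x t.
  by apply/differentiable_continuous/derivable1_diffP; case: dx.
have cv : v @ t --> v t.
  by apply/differentiable_continuous/derivable1_diffP; case: dv.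
have E : \forall s \near t,
    2 * mroot m (hform (x s) (v s)) ^+ 2 / hform (x s) (v s) * hform1 i (x s) (v s) =
    partial i (fun z => Fm m a (x s) z ^+ 2) (v s).
  near=> s; rewrite partial_y_Fm_sqr//; near: s.
    by apply: cx; exact: open_nbhs_nbhs.
  exact: (near_hform_neq0 _ Ux cx cv A0).
have dxs s : size s = m ->
    is_derive t 1 (fun e => a s (x e)) (\sum_r (v t) 0 r * dcoef r (x t) s).
  move=> sm; apply: (is_derive_comp_curve _ dx).
  by have [/(_ _ Ux)] := aC1 sm.
have dvs j : is_derive t 1 (fun e => v e 0 j) (acc 0 j) by exact: is_derive_coord.
have dA := is_derive_hform Ux dxs dvs.
have dH := is_derive_hform1 Ux dxs dvs i.
have D := near_eq_is_derive E (is_derive_legendre (z := t)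
  (A := fun e => hform (x e) (v e)) A0 dA dH).
rewrite partial_x_Fm_sqr//.
have sumE : m%:R * (\sum_j acc 0 j * hess i j (x t) (v t)) =
    (2 - m%:R) * (m%:R * \sum_j acc 0 j * hform1 j (x t) (v t)) * hform1 i (x t) (v t) +
    m%:R * hform (x t) (v t) * ((m%:R - 1) * \sum_j acc 0 j * hform2 i j (x t) (v t)).
  rewrite !mulr_sumr !mulr_suml -big_split/=; apply: eq_bigr => j _.
  by rewrite /hess; ring.
rewrite sumE /spray -/(hform0 _ _) -/(hform10 _ _ _) in D *.
set L := _ ^+ 2 in D *; set A := hform (x t) (v t) in A0 D *.
have L0 : L != 0 by rewrite expf_neq0// mroot_neq0.
set S1 := \sum_j _ in D *; set S2 := \sum_j _ in D *.
split=> [/@derive_val|H].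
  rewrite (@derive_val _ _ _ _ _ _ _ D) => EL.
  have : m%:R * A ^+ 2 / (2 * L) * (2 * L / (m%:R * A ^+ 2) *
     ((2 - m%:R) * (hform0 (x t) (v t) + m%:R * S1) * hform1 i (x t) (v t) +
      m%:R * A * (hform10 i (x t) (v t) + (m%:R - 1) * S2))) =
    m%:R * A ^+ 2 / (2 * L) * (2 * L / (m%:R * A) * hformx i (x t) (v t)).
    by rewrite -EL.
  have -> : m%:R * A ^+ 2 / (2 * L) * (2 * L / (m%:R * A) * hformx i (x t) (v t)) =
     A * hformx i (x t) (v t) by field; rewrite m0 A0 L0.
  rewrite mulrA [X in X * _](_ : _ = 1); last by field; rewrite m0 A0 L0.
  by rewrite mul1r => <-; ring.
apply: (is_derive_eq D).
have -> : (2 - m%:R) * (hform0 (x t) (v t) + m%:R * S1) * hform1 i (x t) (v t) +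
      m%:R * A * (hform10 i (x t) (v t) + (m%:R - 1) * S2) = A * hformx i (x t) (v t).
  by move: H => /eqP; rewrite -subr_eq0 => /eqP H; apply/eqP; rewrite -subr_eq0;
    apply/eqP; rewrite -[RHS]H; ring.
by field; rewrite m0 A0.
Unshelve. all: by end_near.
Qed.

(** * Acceleration parallel to velocity versus the identity *)

Definition hessmx x y : 'M[R]_n := \matrix_(i, j) hess i j x y.

Lemma admissible_neq0 x y : admissible m a x y -> hform x y != 0.
Proof.
by rewrite /admissible h00E => -[A0|[_ A0]]; [rewrite gt_eqF|rewrite lt_eqF].
Qed.

Lemma hessmx_det x y : U x -> hform x y != 0 -> \det (gmx m a x y) != 0 ->
  \det (hessmx x y) != 0.
Proof. by move=> Ux A0; rewrite gmxE// detZ mulf_eq0 negb_or => /andP[]. Qed.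

(** By Euler's relations both terms of [hess] contract to multiples of [hform * hform1], with
    weights 2 - m and m - 1 of sum 1. *)
Lemma hess_euler i x y : \sum_j y 0 j * hess i j x y = hform x y * hform1 i x y.
Proof.
transitivity ((2 - m%:R) * hform1 i x y * (\sum_j y 0 j * hform1 j x y) +
  (m%:R - 1) * hform x y * \sum_j y 0 j * hform2 i j x y).
  by rewrite !mulr_sumr -big_split/=; apply: eq_bigr => j _; rewrite /hess; ring.
by rewrite -hform_euler -hform1_euler; ring.
Qed.

Lemma hform10_euler x y : \sum_i y 0 i * hform10 i x y = hform0 x y.
Proof.
rewrite /hform0; under eq_bigr do rewrite mulr_sumr; rewrite exchange_big/=.
apply: eq_bigr => r _; rewrite hformx_euler mulr_sumr; apply: eq_bigr => i _.
by rewrite mulrCA.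
Qed.

(** By [gamma0E], [spray + hform0 * hform1] equals m - 1 times the right side minus the left side of
    the identity, and m - 1 is nonzero. *)
Lemma spray_identity j x y :
  m%:R * hform x y * gamma0 m a j x y = hform1 j x y * hform0 x y <->
  spray j x y = - (hform0 x y * hform1 j x y).
Proof.
have G : (m%:R - 1) * (m%:R * hform x y * gamma0 m a j x y) =
    hform x y * (m%:R * hform10 j x y - hformx j x y).
  by rewrite -gamma0E; ring.
split=> [I|S].
  move: G; rewrite I => G; apply/eqP; rewrite -subr_eq0; apply/eqP.
  have /eqP := G; rewrite -subr_eq0 => /eqP G0.
  by rewrite -[RHS]G0 /spray; ring.
apply: (mulfI m1); rewrite G; apply/eqP; rewrite -subr_eq0; apply/eqP.
have /eqP := S; rewrite -subr_eq0 => /eqP S0.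
by rewrite -[RHS]oppr0 -[in RHS]S0 /spray; ring.
Qed.

Definition solves_geodesic x y (acc : 'rV[R]_n) :=
  forall i, m%:R * \sum_j acc 0 j * hess i j x y = spray i x y.

(** By [hess_euler] and [spray_identity] this multiple of [y] solves the same linear system as
    [acc], and the matrix is invertible. *)
Lemma acc_parallel x y acc : \det (hessmx x y) != 0 -> hform x y != 0 ->
  (forall j, m%:R * hform x y * gamma0 m a j x y = hform1 j x y * hform0 x y) ->
  solves_geodesic x y acc -> acc = (- hform0 x y / (m%:R * hform x y)) *: y.
Proof.
move=> H0 A0 I EL; set l := _ / _.
have uH : (hessmx x y)^T \in unitmx by rewrite unitmx_tr unitmxE unitfE.
apply: (can_inj (mulmxK uH)); apply/rowP => i; rewrite !mxE.
under eq_bigr do rewrite !mxE; under [RHS]eq_bigr do rewrite !mxE -mulrA.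
apply: (mulfI m0); rewrite EL -mulr_sumr hess_euler (spray_identity i x y).1//.
by rewrite /l; field; rewrite A0 m0.
Qed.

Lemma identity_of_parallel x y l j : hform x y != 0 ->
  solves_geodesic x y (l *: y) ->
  m%:R * hform x y * gamma0 m a j x y = hform1 j x y * hform0 x y.
Proof.
move=> A0 EL.
have EL' i : m%:R * l * hform x y * hform1 i x y = spray i x y.
  rewrite -EL; under eq_bigr do rewrite mxE -mulrA.
  by rewrite -mulr_sumr hess_euler; ring.
(* In the contraction of [spray] with [y], the product [hform * hform0] has coefficient 1 - (2 - m)
   - m = -1. *)
have E : m%:R * l * hform x y * hform x y = - (hform x y * hform0 x y).
  transitivity (\sum_i y 0 i * spray i x y).
    rewrite {2}hform_euler mulr_sumr; apply: eq_bigr => i _; rewrite -EL'; ring.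
  transitivity (hform x y * (\sum_i y 0 i * hformx i x y) -
     (2 - m%:R) * hform0 x y * (\sum_i y 0 i * hform1 i x y) -
     m%:R * hform x y * \sum_i y 0 i * hform10 i x y).
    rewrite /spray; move: (hform0 x y) => f0.
    by rewrite !mulr_sumr -!sumrB; apply: eq_bigr => i _; ring.
  rewrite hform10_euler -(hform_euler x y) -[X in _ * X - _ - _]/(hform0 x y).
  by ring.
apply/spray_identity; rewrite -EL'.
have -> : m%:R * l * hform x y = - hform0 x y.
  by apply: (mulIf A0); rewrite E; ring.
by rewrite mulNr.
Qed.

(** Cramer's formula: with the adjugate, each coordinate is visibly a quotient of continuous
    functions. The transpose appears because accelerations are row vectors. *)
Definition accel x y : 'rV[R]_n := (m%:R * \det (hessmx x y))^-1 *:
  (\row_i spray i x y *m \adj ((hessmx x y)^T)).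

Lemma accelP x y : \det (hessmx x y) != 0 -> solves_geodesic x y (accel x y).
Proof.
move=> H0 i.
transitivity (m%:R * (accel x y *m (hessmx x y)^T) 0 i).
  by rewrite [in RHS]mxE; congr (_ * _); apply: eq_bigr => j _; rewrite !mxE.
rewrite /accel -scalemxAl -mulmxA mul_adj_mx det_tr mul_mx_scalar !mxE.
by field; rewrite H0 m0.
Qed.

(** * Continuity of the acceleration and existence of geodesics *)

Section AccelContinuity.
Variables (T : Type) (F : set_system T) (FF : Filter F).
Variables (x y : T -> 'rV[R]_n) (x0 y0 : 'rV[R]_n).
Hypotheses (Ux0 : U x0) (xF : x @ F --> x0) (yF : y @ F --> y0).

Lemma hess_cvg i j : hess i j (x e) (y e) @[e --> F] --> hess i j x0 y0.
Proof.
apply: cvgD; apply: cvgM; try exact: cvg_cst; apply: cvgM;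
  by [exact: hform_cvg|exact: hform1_cvg|exact: hform2_cvg].
Qed.

Lemma det_hessmx_cvg : \det (hessmx (x e) (y e)) @[e --> F] --> \det (hessmx x0 y0).
Proof.
apply: det_cvg => i j; under [fun e => _]funext do rewrite mxE.
by rewrite mxE; exact: hess_cvg.
Qed.

Lemma spray_cvg i : spray i (x e) (y e) @[e --> F] --> spray i x0 y0.
Proof.
apply: cvgB; first apply: cvgB.
- by apply: cvgM; [exact: hform_cvg|exact: hformx_cvg].
- by apply: cvgM; [apply: cvgM; [exact: cvg_cst|exact: hform0_cvg]|exact: hform1_cvg].
- by apply: cvgM; [apply: cvgM; [exact: cvg_cst|exact: hform_cvg]|exact: hform10_cvg].
Qed.

Lemma accel_cvg : \det (hessmx x0 y0) != 0 ->
  accel (x e) (y e) @[e --> F] --> accel x0 y0.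
Proof.
move=> H0; apply: cvg_row => i.
under [fun e => _]funext do rewrite /accel !mxE; rewrite /accel !mxE.
apply: cvgM.
  apply: cvgV; first by rewrite mulf_neq0.
  by apply: cvgM; [exact: cvg_cst|exact: det_hessmx_cvg].
apply: cvg_big => [|j _]; first exact: add_continuous.
apply: cvgM.
  by under [fun e => _]funext do rewrite mxE; rewrite mxE; exact: spray_cvg.
apply: adj_cvg => k l; under [fun e => _]funext do rewrite !mxE.
by rewrite !mxE; exact: hess_cvg.
Qed.

Lemma near_admissible : admissible m a x0 y0 ->
  \forall e \near F, admissible m a (x e) (y e).
Proof.
have A := hform_cvg FF Ux0 xF yF.
rewrite /admissible h00E => -[A0|[mo A0]].
  apply: (filterS _ (cvgr_gt _ A _ A0)) => e Ae.
  by left; rewrite h00E.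
apply: (filterS _ (cvgr_lt _ A _ A0)) => e Ae.
by right; rewrite h00E.
Qed.

End AccelContinuity.

Lemma geodesic_exists x0 y0 : U x0 -> admissible m a x0 y0 ->
  \det (hessmx x0 y0) != 0 ->
  exists T (x v : R -> 'rV[R]_n), [/\ 0 < T, x 0 = x0, v 0 = y0 &
    forall t, t \in `]- T, T[ -> [/\ U (x t), admissible m a (x t) (v t),
      is_derive t 1 x (v t) &
      exists2 acc, is_derive t 1 v acc & solves_geodesic (x t) (v t) acc]].
Proof.
move=> Ux0 adm0 H0; pose z0 := (x0, y0).
pose g (z : 'rV[R]_n * 'rV[R]_n) := (z.2, accel z.1 z.2).
pose C := `|g z0| + 1.
have gcvg z : U z.1 -> \det (hessmx z.1 z.2) != 0 -> {for z, continuous g}.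
  case: z => z1 z2 /= Uz Hz; have A : accel z.1 z.2 @[z --> (z1, z2)] --> accel z1 z2.
    by apply: (accel_cvg (x := fst) (y := snd) _ Uz _ _ Hz);
      [exact: cvg_fst|exact: cvg_snd].
  have B : z.2 @[z --> (z1, z2)] --> z2 by exact: cvg_snd.
  exact: (cvg_pair B A).
have : \forall z \near z0, [/\ U z.1, admissible m a z.1 z.2,
    \det (hessmx z.1 z.2) != 0 & `|g z| <= C].
  near=> z; split; near: z.
  - have f1 : fst @ z0 --> x0 by exact: cvg_fst.
    by apply: f1; exact: open_nbhs_nbhs.
  - by apply: (near_admissible (x := fst) (y := snd) _ Ux0 _ _ adm0);
      [exact: cvg_fst|exact: cvg_snd].
  - apply: (cvgr_neq0 (\det (hessmx x0 y0))) => //.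
    by apply: (det_hessmx_cvg (x := fst) (y := snd) _ Ux0); [exact: cvg_fst|exact: cvg_snd].
  - have := gcvg z0 Ux0 H0 => /cvg_norm gn.
    by apply: (cvgr_le _ gn); rewrite ltrDl.
move=> /nbhs_ballP[r /= r0 rP].
(* Off the ball nothing is known about [g], so it is replaced by 0. The jump at the boundary is
   harmless: the solution has speed at most [C] and stays inside the open ball for times below
   [r / C]. *)
pose f z := if `[< ball z0 r z >] then g z else 0.
have C0 : 0 < C by rewrite ltr_wpDl.
have fC z : `|f z| <= C.
  rewrite /f; case: asboolP => [/rP[]//|_]; rewrite normr0; exact: ltW.
have Vc (rr : R) : compact [set z : 'rV[R]_n * 'rV[R]_n | `|z| <= rr].
  by apply: compact_ball_prod; exact: compact_ball_rV.
have [z [zz0 zC zf]] := peano Vc z0 fC.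
exists (r / C), (fun t => (z t).1), (fun t => (z t).2).
rewrite divr_gt0// zz0; split => // t tI.
have zb : ball z0 r (z t).
  rewrite -ball_normE /= distrC; apply: (le_lt_trans (zC t)).
  by move: tI; rewrite in_itv/= -ltr_norml ltr_pdivlMr// mulrC.
have [Ut at_ Ht _] := rP _ zb.
have fz : {for z t, continuous f}.
  have near_b : \forall w \near z t, ball z0 r w.
    by apply: open_nbhs_nbhs; split => //; exact: ball_open.
  have E : \forall w \near z t, g w = f w.
    by apply: filterS near_b => w wb; rewrite /f asboolT.
  rewrite /prop_for /continuous_at -(nbhs_singleton E).
  by apply: cvg_trans (gcvg _ Ut Ht); exact: near_eq_cvg.
have dz := zf t fz.
have fE : f (z t) = g (z t) by rewrite /f asboolT.
rewrite fE in dz; split => //; first exact: (is_derive_fst dz).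
exists (accel (z t).1 (z t).2); first exact: (is_derive_snd dz).
exact: accelP.
Unshelve. all: by end_near.
Qed.

Lemma hform_neq0_vec x y : hform x y != 0 -> y != 0.
Proof.
apply: contra_neq => ->; rewrite hform_euler big1// => i _.
by rewrite mxE mul0r.
Qed.

Lemma geodesic_curve_acc (t0 t1 : R) (x : R -> 'rV[R]_n) :
  geodesic_curve m a t0 t1 x -> (forall t, t \in `]t0, t1[ -> U (x t)) ->
  forall t, t \in `]t0, t1[ ->
  [/\ admissible m a (x t) (derive1 x t), is_derive t 1 x (derive1 x t) &
   exists2 acc, is_derive t 1 (derive1 x) acc &
     solves_geodesic (x t) (derive1 x t) acc].
Proof.
move=> G Ux t tI; have [dx ddx adm EL] := G t tI.
have dx' : is_derive t 1 x (derive1 x t) := DeriveDef dx (esym (derive1E x t)).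
split => //; exists ('D_1 (derive1 x) t); first exact: derivableP.
move=> i; have A0 := admissible_neq0 adm.
exact: (euler_lagrangeE i dx' (derivableP ddx) (Ux t tI) A0).1 (EL i).
Qed.

(** Here [y] stands for the solution [x] sent to the manifold and read back in the chart, a round
    trip that is the identity only on the image of the chart; hence the agreement on the interval
    alone. *)
Lemma geodesic_curve_of_solution (t0 t1 : R) (x v y : R -> 'rV[R]_n) :
  (forall t, t \in `]t0, t1[ -> y t = x t) ->
  (forall t, t \in `]t0, t1[ -> [/\ U (x t), admissible m a (x t) (v t),
      is_derive t 1 x (v t) &
      exists2 acc, is_derive t 1 v acc & solves_geodesic (x t) (v t) acc]) ->
  geodesic_curve m a t0 t1 y.
Proof.
move=> yx H.
have nearI t : t \in `]t0, t1[ -> \forall s \near t, s \in `]t0, t1[.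
  exact: near_in_itvoo.
have dy t : t \in `]t0, t1[ -> is_derive t 1 y (v t).
  move=> tI; have [_ _ dx _] := H t tI.
  by apply: near_eq_is_derive dx; apply: filterS (nearI t tI) => s /yx.
have yv t : t \in `]t0, t1[ -> derive1 y t = v t.
  by move=> /dy D; rewrite derive1E; exact: derive_val.
move=> t tI; have [Ut adm dx [acc dv sol]] := H t tI.
split; first by have [] := dy t tI.
- suff [] : is_derive t 1 (derive1 y) acc by [].
  by apply: near_eq_is_derive dv; apply: filterS (nearI t tI) => s /yv.
- by rewrite (yx t tI) (yv t tI).
move=> i; rewrite (yx t tI) (yv t tI).
have A0 := admissible_neq0 adm.
apply: near_eq_is_derive ((euler_lagrangeE i dx dv Ut A0).2 (sol i)).
by apply: filterS (nearI t tI) => s sI; rewrite (yx s sI) (yv s sI).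
Qed.

(** * Functions polynomial along every line in y *)

Let pline (g : 'rV[R]_n -> R) := forall y w, exists p : {poly R},
  forall t, g (y + t *: w) = p.[t].

Let plineM g h : pline g -> pline h -> pline (fun y => g y * h y).
Proof.
move=> G H y w; have [[p pE] [q qE]] := (G y w, H y w).
by exists (p * q) => t; rewrite hornerM pE qE.
Qed.

Let plineB g h : pline g -> pline h -> pline (fun y => g y - h y).
Proof.
move=> G H y w; have [[p pE] [q qE]] := (G y w, H y w).
by exists (p - q) => t; rewrite hornerD hornerN pE qE.
Qed.

Let pline_sum (g : 'I_n -> 'rV[R]_n -> R) : (forall i, pline (g i)) ->
  pline (fun y => \sum_i g i y).
Proof.
move=> G y w; have /choice[p pE] : forall i, exists p : {poly R},
  forall t, g i (y + t *: w) = p.[t] by move=> i; exact: G.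
by exists (\sum_i p i) => t; rewrite horner_sum; apply: eq_bigr => i _.
Qed.

Let pline_cst c : pline (fun=> c).
Proof. by move=> y w; exists c%:P => t; rewrite hornerC. Qed.

Let pline_coord i : pline (fun y => y 0 i).
Proof.
move=> y w; exists ((y 0 i)%:P + w 0 i *: 'X) => t.
by rewrite !hornerE !mxE mulrC.
Qed.

Let pline_contract al k s : pline (ycontract al k s).
Proof. by move=> y w; exact: ycontract_poly. Qed.

(* Both sides are polynomials along the line from y0 to y, and they agree near
   y0 because admissibility is an open condition. *)
Lemma identity_extend x y0 j : U x -> admissible m a x y0 ->
  (forall y, admissible m a x y ->
    m%:R * hform x y * gamma0 m a j x y = hform1 j x y * hform0 x y) ->
  forall y, m%:R * hform x y * gamma0 m a j x y = hform1 j x y * hform0 x y.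
Proof.
move=> Ux adm0 I y.
(* This is m - 1 times the difference of the two sides, with [gamma0] expanded by [gamma0E] into
   contractions. *)
pose D y := hform x y * (m%:R * hform10 j x y - hformx j x y) -
  (m%:R - 1) * (hform1 j x y * hform0 x y).
have DE z : (m%:R - 1) * (m%:R * hform x z * gamma0 m a j x z -
    hform1 j x z * hform0 x z) = D z.
  by rewrite /D -gamma0E; ring.
have pform0 : pline (hform0 x).
  by apply: pline_sum => r; exact: plineM (pline_coord r) (pline_contract _ _ _).
have pform10 : pline (hform10 j x).
  by apply: pline_sum => r; exact: plineM (pline_coord r) (pline_contract _ _ _).
have pform : pline (hform x) by exact: pline_contract.
have pformx : pline (hformx j x) by exact: pline_contract.
have pform1 : pline (hform1 j x) by exact: pline_contract.
have [p pE] := plineB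
  (plineM pform (plineB (plineM (pline_cst m%:R) pform10) pformx))
  (plineM (pline_cst (m%:R - 1)) (plineM pform1 pform0)) y0 (y - y0).
have p0 : p = 0.
  apply: poly_near0.
  have L : (fun t : R => y0 + t *: (y - y0)) @ (0 : R) --> y0.
    have Z : (t : R) *: (y - y0) @[t --> (0 : R)] --> 0 *: (y - y0).
      exact: cvgZ cvg_id (cvg_cst _).
    have := cvgD (cvg_cst y0) Z; rewrite scale0r addr0; exact.
  have N := near_admissible (x := fun=> x) (nbhs_filter (0 : R)) Ux (cvg_cst _) L adm0.
  near=> t; have E : admissible m a x (y0 + t *: (y - y0)) by near: t; exact: N.
  by rewrite -pE -/(D _) -DE (I _ E) subrr mulr0.
apply/eqP; rewrite -subr_eq0; apply/eqP; apply: (mulfI m1); rewrite DE mulr0.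
have := pE 1; rewrite p0 horner0 => <-.
by rewrite scale1r [y0 + _]addrC subrK.
Unshelve. all: by end_near.
Qed.

End Metric.

(** * From one coordinate system to the manifold *)

Lemma cimgK (R : realType) (M : topologicalType) (n : nat) (phi : chart R M n) x :
  cimg phi x -> cdom phi (chart_inv phi x) /\ chart_coord phi (chart_inv phi x) = x.
Proof. by case=> q qd <-; rewrite chart_coordK. Qed.

Theorem theorem17 (R : realType) (M : topologicalType) (n m : nat)
    (M_hausdorff : hausdorff_space M) (M_countable : @second_countable M)
    (S : smooth_structure R M n) (m_ge2 : (2 <= m)%N)
    (a : mroot_metric m S) :
  projectively_flat a <->
  (forall p : M, exists phi : chart R M n,
    [/\ atlas S phi, cdom phi p &
      forall (x y : 'rV[R]_n) (j : 'I_n), cimg phi x ->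
        m%:R * h00 m (acomp a phi) x y * gamma0 m (acomp a phi) j x y =
        h0 m (acomp a phi) j x y *
        \sum_(r < n) y 0 r * h00x m (acomp a phi) r x y]).
Proof.
have aC1 phi : atlas S phi -> forall s, seq.size s = m -> Ck 1 (cimg phi) (acomp a phi s).
  by move=> Aphi s /eqP sm; exact: (acomp_smooth a (Tuple sm) Aphi 1).
have aS phi : atlas S phi -> forall x, cimg phi x ->
    symm_coef m ((acomp a phi)^~ x).
  move=> Aphi x Ux s t sm st; have /eqP sm' := sm.
  have tm : seq.size t == m by rewrite -(perm_size st) sm.
  exact: (@acomp_sym _ _ _ _ _ a phi (Tuple sm') (Tuple tm) x).
have oU (phi : chart R M n) : open (cimg phi) by exact: open_cimg.
have idE phi (Aphi : atlas S phi) x y j (Ux : cimg phi x) :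
    (m%:R * h00 m (acomp a phi) x y * gamma0 m (acomp a phi) j x y =
        h0 m (acomp a phi) j x y *
        \sum_(r < n) y 0 r * h00x m (acomp a phi) r x y) =
    (m%:R * hform (m := m) (acomp a phi) x y * gamma0 m (acomp a phi) j x y =
     hform1 (m := m) (acomp a phi) j x y * hform0 (m := m) (acomp a phi) x y).
  rewrite h00E h0E; congr (_ = _ * _); apply: eq_bigr => r _.
  by rewrite (h00xE (aC1 phi Aphi) (aS phi Aphi)).
have det0 phi (Aphi : atlas S phi) x y : cimg phi x -> admissible m (acomp a phi) x y ->
    \det (hessmx (m := m) (acomp a phi) x y) != 0.
  move=> Ux adm.
  apply: (hessmx_det m_ge2 (aC1 phi Aphi) (aS phi Aphi) Ux).
    exact: admissible_neq0 adm.
  exact: (metric_nondegenerate Aphi Ux adm).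
(* The same coordinate system serves in both directions. *)
split=> H p; have [phi [Aphi phip Hphi]] := H p; exists phi; split => //.
- move=> x y j Ux; rewrite idE//.
  have [y0 adm0] := metric_domain_nonempty a Aphi Ux.
  apply: (identity_extend m_ge2 (aC1 phi Aphi) Ux adm0).
  move=> {}y adm.
  have [T [c [v [T0 c0 v0 sol]]]] := geodesic_exists m_ge2 (oU phi)
    (aC1 phi Aphi) Ux adm (det0 _ Aphi _ _ Ux adm).
  have cE t : t \in `]- T, T[ -> (chart_coord phi \o (chart_inv phi \o c)) t = c t.
    by move=> /sol[/cimgK[]].
  have geo : geodesic_in a phi (- T) T (chart_inv phi \o c).
    split; first by move=> t /sol[/cimgK[]].
    exact: (geodesic_curve_of_solution m_ge2 (oU phi) (aC1 phi Aphi) (aS phi Aphi) cE sol).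
  have TT : - T < T by rewrite gtrN.
  have I0 : 0 \in `]- T, T[ by rewrite in_itv/= oppr_lt0 T0.
  have [q [u [u0 line]]] := Hphi _ _ _ TT geo.
  have straight : on_straight_line (- T) T c.
    by exists q, u; split => // t tI; have [s sE] := line t tI; exists s; rewrite -cE.
  have [_ _ _ [acc dv EL]] := sol 0 I0.
  rewrite c0 v0 in EL; have A0 := admissible_neq0 adm.
  have dc t : t \in `]- T, T[ -> is_derive t 1 c (v t) by move=> /sol[].
  have vne : v 0 != 0 by rewrite v0; exact: (hform_neq0_vec m_ge2 A0).
  have [l lE] := parallel_of_straight T0 dc dv vne straight.
  rewrite lE v0 in EL.
  exact: (identity_of_parallel m_ge2 j A0 EL).
- move=> t0 t1 c t01 [cdomc geo].
  have Ux t : t \in `]t0, t1[ -> cimg phi ((chart_coord phi \o c) t).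
    by move=> tI; exists (c t) => //; exact: cdomc.
  apply: (straight_of_parallel (v := derive1 (chart_coord phi \o c))) => // t tI.
  have [adm dx [acc dv EL]] := geodesic_curve_acc m_ge2 (oU phi) (aC1 phi Aphi)
    (aS phi Aphi) geo Ux tI.
  have A0 := admissible_neq0 adm.
  split => //; first exact: (hform_neq0_vec m_ge2 A0).
  set x := chart_coord phi \o c in Ux adm dx acc dv EL A0 *.
  have I j := Hphi _ (derive1 x t) j (Ux t tI).
  exists (- hform0 (m := m) (acomp a phi) (x t) (derive1 x t) /
     (m%:R * hform (m := m) (acomp a phi) (x t) (derive1 x t))).
  rewrite -(acc_parallel m_ge2 _ A0 _ EL)//; first exact: det0 (Ux t tI) adm.
  by move=> k; rewrite -(idE _ Aphi _ _ k (Ux t tI)); exact: I.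
Qed.
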